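(* Let $\mathcal{K} = \{K_n : n \in \omega\}$ be a countably infinite set of compact subsets of $(0,1)$, no two of which are order isomorphic. There exists a $\mathcal{K}$-fan $X$. Moreover, if $E_{\mathcal{K}} = \{e_n : n \in \omega\} \subseteq E(X)$ is the witnessing set as in the definition of $\mathcal{K}$-fan and $p$ is the vertex of $X$, then $X$ can be constructed so that any chosen one of the following holds: (1) (assuming $\emptyset \notin \mathcal{K}$) $E(X)$ is homeomorphic to the natural numbers (countably infinite discrete space) and $E(X) = E_{\mathcal{K}}$; or (2) $E(X)$ is homeomorphic to the space of irrational numbers, and for each $e \in E(X) \setminus E_{\mathcal{K}}$, $\overline{E(X)} \cap pe = \{e\}$; or (3) $E(X)$ is homeomorphic to the product of the Cantor set with the (discrete) natural numbers, and for each $e \in E(X) \setminus E_{\mathcal{K}}$, $\overline{E(X)} \cap pe = \{p,e\}$.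
   Context: $\omega = \{0,1,2,\ldots\}$. A continuum is a compact connected metric space; it is non-degenerate if it has more than one point. The Cantor fan $F_C$ is the cone over the Cantor set $C$. A smooth fan is a non-degenerate continuum $X$ homeomorphic to a subcontinuum of $F_C$; it is always assumed that the embedding is such that the image contains the cone point and the cone point has order at least $2$ in $X$. The point of $X$ corresponding to the cone point is the vertex of $X$ (it is uniquely determined if its order is at least $3$). Here a point $x$ has order at least $n$ in $X$ if there are $n$ arcs in $X$ having $x$ as one endpoint which are otherwise pairwise disjoint. An endpoint of $X$ is a point of order exactly $1$; $E(X)$ denotes the set (subspace) of endpoints of $X$. For distinct $x,y \in X$, $xy$ is the unique arc in $X$ with endpoints $x$ and $y$. Closures are taken in $X$. Two subsets $A_1, A_2$ of $(0,1)$ are order isomorphic if there is an order preserving homeomorphism $h \colon [0,1] \to [0,1]$ with $h(A_1) = A_2$. For an endpoint $e$ of a smooth fan with vertex $p$, a subset of $pe \setminus \{p,e\}$ is regarded as a subset of $(0,1)$ by means of a homeomorphism $pe \to [0,1]$ sending $p$ to $0$ and $e$ to $1$. For $\mathcal{K}$ as in the statement, a smooth fan $X$ with vertex $p$ is a $\mathcal{K}$-fan if there exists a subset $E_{\mathcal{K}} = \{e_n : n \in \omega\} \subseteq E(X)$ such that: (i) for each $n \in \omega$, $\overline{E(X)} \cap pe_n \setminus \{p,e_n\}$ is order isomorphic to $K_n$; (ii) for each $e \in E(X) \setminus E_{\mathcal{K}}$, $\overline{E(X)} \cap pe \setminus \{p,e\}$ is not order isomorphic to any element of $\mathcal{K}$;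 and (iii) for each $e \in E(X) \setminus E_{\mathcal{K}}$, $\overline{E_{\mathcal{K}}} \cap pe \setminus \{p\} \neq \emptyset$.
   Formalization: Items (2) and (3) are also stated assuming ∅ ∉ K: if ∅ ∈ K, then, as E(X) is uncountable, some e ∈ E(X) \ E_K has closure(E(X)) ∩ pe \ {p,e} = ∅, which is order isomorphic to ∅ ∈ K, contradicting (ii). *)

(* Defs.v *)
From HB Require Import structures.
From mathcomp Require Import all_boot all_order all_algebra.
From mathcomp Require Import generic_quotient.
From mathcomp Require Import all_classical all_reals.
From mathcomp Require Import topology normedtype cantor.

Set Implicit Arguments.
Unset Strict Implicit.
Unset Printing Implicit Defensive.

Import Order.TTheory GRing.Theory Num.Theory.
Import numFieldNormedType.Exports.

Local Open Scope classical_set_scope.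
Local Open Scope ring_scope.
Local Open Scope quotient_scope.

(* Homeomorphisms between subspaces are carried by total functions between the
   ambient spaces; only the values on [A] (resp. [B]) matter. *)
Definition homeomorphism {T U : topologicalType} (A : set T) (B : set U)
    (f : T -> U) : Prop :=
  [/\ set_bij A B f, {within A, continuous f} &
      exists2 g : U -> T, {within B, continuous g} & {in A, cancel f g}].

Definition homeomorphic {T U : topologicalType} (A : set T) (B : set U) : Prop :=
  exists f : T -> U, homeomorphism A B f.

Section cone.
Context (R : realType) (T : ptopologicalType).

Definition cone_cylinder : Type := (T * set_type [set` `[0%R, 1%R : R]])%type.

HB.instance Definition _ := Topological.on cone_cylinder.

Let cone_rel' (a b : cone_cylinder) : bool :=
  (a == b) || ((\val a.2 == 0) && (\val b.2 == 0)).

Local Lemma cone_rel_refl : reflexive cone_rel'.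
Proof. by move=> a; rewrite /cone_rel' eqxx. Qed.

Local Lemma cone_rel_sym : symmetric cone_rel'.
Proof. by move=> a b; rewrite /cone_rel' eq_sym andbC. Qed.

Local Lemma cone_rel_trans : transitive cone_rel'.
Proof.
move=> b a c /predU1P[-> //|/andP[a0 b0]] /predU1P[<-|/andP[_ c0]];
  by rewrite /cone_rel' ?a0 ?b0 ?c0 orbT.
Qed.

Definition cone_rel := EquivRel _ cone_rel_refl cone_rel_sym cone_rel_trans.

(* T x [0, 1] with T x {0} collapsed to a point *)
Definition cone : Type := {eq_quot cone_rel}.

HB.instance Definition _ := Topological.copy cone (quotient_topology cone).
HB.instance Definition _ := Quotient.on cone.

Local Lemma zero_in_itv : (0 : R) \in [set` `[0%R, 1%R : R]].
Proof. by rewrite inE /= in_itv /= lexx ler01. Qed.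

(* independent of the first coordinate *)
Definition cone_point : cone := \pi_cone (point, exist _ 0 zero_in_itv).

End cone.

Definition cantor_fan (R : realType) : topologicalType := cone R cantor_space.

Definition continuum {T : topologicalType} (A : set T) : Prop :=
  compact A /\ connected A.

Section fans.
Context {R : realType}.

Definition order_isomorphic (A B : set R) : Prop :=
  exists h : R -> R,
    [/\ @homeomorphism R R `[0, 1] `[0, 1] h,
        {in `[0, 1] &, {homo h : x y / x <= y}} &
        h @` A = B].

Context {X : metricType R}.

Definition is_arc (A : set X) (x y : X) : Prop :=
  exists f : R -> X, [/\ @homeomorphism R X `[0, 1] A f, f 0 = x & f 1 = y].

(* The arc from [x] to [y]; only meaningful when it exists and is unique, as
   happens for distinct points of a smooth fan. *)
Definition arc_joining (x y : X) : set X :=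
  xget set0 [set A : set X | is_arc A x y].

Definition order_at_least (x : X) (n : nat) : Prop :=
  exists A : 'I_n -> set X,
    (forall i, exists y, is_arc (A i) x y) /\
    (forall i j, i != j -> A i `&` A j = [set x]).

Definition endpoints : set X :=
  [set x | order_at_least x 1 /\ ~ order_at_least x 2].

(* [X] is a smooth fan with vertex [p] *)
Definition smooth_fan (p : X) : Prop :=
  [/\ continuum [set: X],
      exists x y : X, x <> y,
      exists (Y : set (cantor_fan R)) (f : X -> cantor_fan R),
        [/\ continuum Y, homeomorphism [set: X] Y f &
            f p = cone_point R cantor_space] &
      order_at_least p 2].

(* The choice of [phi] is immaterial: two such parametrizations differ by an
   increasing homeomorphism of [0, 1]. *)
Definition leg_order_isomorphic (p e : X) (S : set X) (B : set R) : Prop :=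
  exists phi : X -> R,
    [/\ @homeomorphism X R (arc_joining p e) `[0, 1] phi,
        phi p = 0, phi e = 1 & order_isomorphic (phi @` S) B].

Definition leg_trace (p e : X) : set X :=
  (closure endpoints `&` arc_joining p e) `\` [set p; e].

(* [X] is a K-fan with vertex [p], where K = {K n | n} and the witnessing set
   is {e n | n}. *)
Definition K_fan_with (K : nat -> set R) (p : X) (e : nat -> X) : Prop :=
  [/\ smooth_fan p,
      range e `<=` endpoints,
      forall n, leg_order_isomorphic p (e n) (leg_trace p (e n)) (K n),
      forall x, (endpoints `\` range e) x ->
        forall n, ~ leg_order_isomorphic p x (leg_trace p x) (K n) &
      forall x, (endpoints `\` range e) x ->
        (closure (range e) `&` arc_joining p x) `\` [set p] !=set0].

Definition K_fan (K : nat -> set R) (p : X) : Prop :=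
  exists e : nat -> X, K_fan_with K p e.

End fans.

Arguments endpoints {R} X.

(* Main.v *)
(** The fan lives over the Cantor space: the leg over [c] has height
[profile m q c], an infinite product of the numbers [q n j] over the positions
[j] at which [c] has a one and [m j] holds, [n] being the number spelled by the
bits of [c] below [j]. The legs [e_n] sit over the binary expansions of natural
numbers [n]. If [q n] runs densely through a small rescaled copy [Kt n] of
[K n], then the endpoints over [n + 2 ^ j] accumulate, on the leg over [n],
exactly at the points of height in [profile m q (bits n) * Kt n], because any
further factor is close to 0 (when [Kt n] lies near 0, cases 1 and 3) or to 1
(when [Kt n] lies near 1, case 2). Marking all positions isolates every
endpoint; marking only the odd ones makes the unmarked even bits produce
Cantor sets of endpoints of equal height. *)

From HB Require Import structures.
Require Import Defs.
From mathcomp Require Import all_boot all_order all_algebra.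
From mathcomp Require Import generic_quotient.
From mathcomp Require Import all_classical all_reals.
From mathcomp Require Import topology normedtype sequences cantor.
From mathcomp Require Import ring lra zify.

Set Implicit Arguments.
Unset Strict Implicit.
Unset Printing Implicit Defensive.

Import Order.TTheory GRing.Theory Num.Theory.
Import numFieldNormedType.Exports.

Local Open Scope classical_set_scope.
Local Open Scope ring_scope.
Local Open Scope quotient_scope.

(** * The Cantor space and its ternary embedding *)

Section agreement.
Implicit Types (c d : cantor_space) (k : nat).

Definition agree k c d : Prop := forall i, (i < k)%N -> c i = d i.

Lemma agree_sym k c d : agree k c d -> agree k d c.
Proof. by move=> cd i ik; rewrite cd. Qed.

Lemma agree_trans k c d e : agree k c d -> agree k d e -> agree k c e.
Proof. by move=> cd de i ik; rewrite cd// de. Qed.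

Lemma agree_le j k c d : (j <= k)%N -> agree k c d -> agree j c d.
Proof. by move=> jk cd i ij; rewrite cd// (leq_trans ij). Qed.

Lemma agreeS k c d : agree k c d -> c k = d k -> agree k.+1 c d.
Proof. by move=> cd ck i; rewrite ltnS leq_eqVlt => /predU1P[->|/cd]. Qed.

Lemma eq_agree c d : (forall k, agree k c d) -> c = d.
Proof. by move=> cd; apply/funext => i; apply: (cd i.+1). Qed.

Lemma first_difference c d : c <> d ->
  exists2 k, agree k c d & c k != d k.
Proof.
move=> cd; have /existsNP[i /eqP ci] : ~ forall i, c i = d i.
  by move=> ?; apply: cd; apply/funext.
have ex : exists i, c i != d i by exists i.
exists (ex_minn ex); case: ex_minnP => // m cm minm j jm.
by apply/eqP; apply: contraTT jm => /minm; rewrite -leqNgt.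
Qed.

Lemma nbhs_cantorP c (P : set cantor_space) :
  nbhs c P <-> exists k, forall d, agree k c d -> P d.
Proof.
split.
  pose F := filter_from [set: nat] (fun k => agree k c).
  have FF : Filter F.
    apply: filter_from_filter; first by exists 0%N.
    move=> i j _ _; exists (maxn i j) => // d cd.
    by split; apply: agree_le cd; rewrite ?leq_maxl ?leq_maxr.
  suff Fc : F --> c by move/Fc => [k _ kP]; exists k => d /kP.
  apply/cvg_sup => i; apply/cvg_image.
    by rewrite eqEsubset; split=> // b _; exists (fun=> b).
  move=> A /nbhs_singleton Ac; exists [set d | A (d i)].
    by exists i.+1 => // d cd /=; rewrite -cd.
  rewrite eqEsubset; split => [b [d /= Ad <-]//|b Ab].
  by exists (fun=> b).
move=> [k kP]; apply: (filterS kP); elim: k {kP} => [|k IH].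
  by apply: filterS filterT => d _ i.
have ck : nbhs c [set d | d k = c k].
  apply: (@proj_continuous nat (fun=> bool) k c [set c k]).
  exact: discrete_set1.
by apply: filterS2 IH ck => d cd /= dk; exact: agreeS.
Qed.

End agreement.

Section ternary.
Context {R : realType}.
Implicit Types (c d : cantor_space) (k : nat).

Definition ternary_sum k c : R := \sum_(i < k) (c i)%:R * 2 * 3^-1 ^+ i.+1.

Definition ternary c : R := sup (range (ternary_sum ^~ c)).

Lemma ternary_sumS k c :
  ternary_sum k.+1 c = ternary_sum k c + (c k)%:R * 2 * 3^-1 ^+ k.+1.
Proof. by rewrite /ternary_sum big_ord_recr. Qed.

Lemma agree_ternary_sum k c d :
  agree k c d -> ternary_sum k c = ternary_sum k d.
Proof. by move=> cd; apply: eq_bigr => i _; rewrite cd. Qed.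

Lemma le_ternary_sum c j k : (j <= k)%N ->
  ternary_sum j c <= ternary_sum k c <= ternary_sum j c + 3^-1 ^+ j - 3^-1 ^+ k.
Proof.
move=> /subnK <-; elim: (k - j)%N => [|n /andP[IH1 IH2]].
  by rewrite add0n addrK !lexx.
have p : (0 : R) < 3^-1 ^+ (n + j) by rewrite exprn_gt0// invr_gt0.
rewrite addSn ternary_sumS [in _ - _]exprS.
rewrite [3^-1 ^+ (n + j).+1]exprS; case: (c _) => /=; apply/andP; split; lra.
Qed.

Lemma ternary_sum_le k c : ternary_sum k c <= ternary c.
Proof.
apply: ub_le_sup; last by exists k.
exists 1 => _ [j _ <-]; have /andP[_] := le_ternary_sum c (leq0n j).
have : (0 : R) < 3^-1 ^+ j by rewrite exprn_gt0// invr_gt0.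
by rewrite /ternary_sum big_ord0 expr0; lra.
Qed.

Lemma ternary_le k c : ternary c <= ternary_sum k c + 3^-1 ^+ k.
Proof.
apply: ge_sup; first by exists (ternary_sum 0 c); exists 0%N.
move=> _ [j _ <-].
have p n : (0 : R) < 3^-1 ^+ n by rewrite exprn_gt0// invr_gt0.
have := p j; have := p k.
case: (leqP j k) => [/(le_ternary_sum c)|/ltnW/(le_ternary_sum c)] /andP[]; lra.
Qed.

Lemma ternary_ge0 c : 0 <= ternary c.
Proof. by have := ternary_sum_le 0 c; rewrite /ternary_sum big_ord0. Qed.

Lemma ternary_le1 c : ternary c <= 1.
Proof. by have := ternary_le 0 c; rewrite /ternary_sum big_ord0 add0r. Qed.

Lemma agree_ternary k c d :
  agree k c d -> `|ternary c - ternary d| <= 3^-1 ^+ k.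
Proof.
move=> cd; have := ternary_le k c; have := ternary_le k d.
have := ternary_sum_le k c; have := ternary_sum_le k d.
by rewrite (agree_ternary_sum cd) ler_distl => *; apply/andP; split; lra.
Qed.

Lemma ternary_gap k c d : agree k c d -> ~~ c k -> d k ->
  ternary c <= ternary_sum k c + 3^-1 ^+ k.+1 /\
  ternary_sum k c + 2 * 3^-1 ^+ k.+1 <= ternary d.
Proof.
move=> cd /negbTE ck dk; have := ternary_le k.+1 c.
have := ternary_sum_le k.+1 d; rewrite !ternary_sumS ck dk.
rewrite (agree_ternary_sum cd) /=; split; lra.
Qed.

Lemma ternary_agree k c d :
  `|ternary c - ternary d| < 3^-1 ^+ k -> agree k c d.
Proof.
move=> cdk; case: (pselect (c = d)) => [->//|/first_difference[j cd cdj]].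
have [/agree_le|jk] := leqP k j; first exact.
have : `|ternary c - ternary d| >= 3^-1 ^+ j.+1.
  case: (boolP (c j)) cdj => cj; case: (boolP (d j)) => dj //= _.
    by have [] := ternary_gap (agree_sym cd) dj cj; rewrite ler_normr; lra.
  by have [] := ternary_gap cd cj dj; rewrite ler_normr; lra.
move=> /le_lt_trans /(_ cdk); rewrite ltNge ler_wiXn2l ?invr_ge0 ?invf_le1//.
by rewrite ler1n.
Qed.

Lemma ternary_inj c d : ternary c = ternary d -> c = d.
Proof.
move=> cd; apply: eq_agree => k; apply: ternary_agree.
by rewrite cd subrr normr0 exprn_gt0// invr_gt0.
Qed.

Lemma ternary_skips c d : ternary c < ternary d ->
  exists2 y, ternary c < y < ternary d & forall e, ternary e <> y.
Proof.
move=> cd; have /first_difference[k ak ck] : c <> d.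
  by move=> cd'; rewrite cd' ltxx in cd.
have p n : (0 : R) < 3^-1 ^+ n by rewrite exprn_gt0// invr_gt0.
have [ck0 dk1] : ~~ c k /\ d k.
  move: ck; case: (boolP (c k)) => c0; case: (boolP (d k)) => d0 //= _.
  have [] := ternary_gap (agree_sym ak) d0 c0; have := p k.+1; lra.
have [gc gd] := ternary_gap ak ck0 dk1; have pk := p k.+1.
exists (ternary_sum k c + 3 / 2 * 3^-1 ^+ k.+1).
  by apply/andP; split; lra.
move=> e ey; case: (pselect (agree k c e)) => [ce|nce].
  case: (boolP (e k)) => ek.
    have [] := ternary_gap ce ck0 ek; lra.
  have [] := ternary_gap (agree_trans (agree_sym ce) ak) ek dk1.
  rewrite -(agree_ternary_sum ce); lra.
have /first_difference[j ce] : c <> e by move=> ce; apply: nce; rewrite ce.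
have [/agree_le/(_ ce)//|jk cej] := leqP k j.
have de : agree j d e by apply: agree_trans ce; exact/agree_sym/(agree_le (ltnW jk)).
have cdj := ak _ jk; move: cej; have := p j.+1.
case: (boolP (c j)) => cj; case: (boolP (e j)) => ej //=.
  by have [] := ternary_gap (agree_sym ce) ej cj; lra.
by rewrite cdj in cj; have [] := ternary_gap de cj ej; lra.
Qed.

End ternary.

(** * The metric space of a fan *)

Lemma within_continuous_eq {T U : topologicalType} (A : set T) (f g : T -> U) :
  (forall x, A x -> f x = g x) -> {within A, continuous f} ->
  {within A, continuous g}.
Proof.
move=> fg /subspace_continuousP cf; apply/subspace_continuousP => x Ax.
suff : g y @[y --> within A (nbhs x)] --> g x by [].
rewrite -fg//; apply: cvg_trans (cf x Ax); apply: near_eq_cvg.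
by apply: filterS (withinT _ _) => y /fg.
Qed.

Lemma within_continuousI {T U : topologicalType} (A : set T) (f : T -> U) :
  (forall x P, A x -> nbhs (f x) P -> \forall y \near x, A y -> P (f y)) ->
  {within A, continuous f}.
Proof. by move=> cf; apply/subspace_continuousP => x Ax P; exact: cf. Qed.

Lemma within_continuous_mdist {R : realType} {T : topologicalType}
    {Y : metricType R} (A : set T) (f : T -> Y) :
  (forall x e, A x -> 0 < e ->
     \forall y \near x, A y -> mdist (f x) (f y) < e) ->
  {within A, continuous f}.
Proof.
move=> cf; apply/subspace_continuousP => x Ax P /nbhs_ballP[e /= e0 eP].
apply: filterS (cf x e Ax e0) => y + Ay.
by move=> /(_ Ay) fxy; apply: eP; rewrite ballEmdist.
Qed.

Lemma homeomorphism_cancel {T U : topologicalType} (A : set T) (B : set U)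
    (f : T -> U) (g : U -> T) :
  (forall x, A x -> B (f x)) -> (forall y, B y -> A (g y)) ->
  (forall x, A x -> g (f x) = x) -> (forall y, B y -> f (g y) = y) ->
  {within A, continuous f} -> {within B, continuous g} -> homeomorphism A B f.
Proof.
move=> fAB gBA fK gK cf cg; split=> //.
  split=> [//|x y|y By].
    by rewrite !inE => Ax Ay fxy; rewrite -(fK x)// fxy fK.
  by exists (g y); [exact: gBA | exact: gK].
by exists g => // x; rewrite inE => /fK.
Qed.

(* A point [(c, t)] of the cone is placed at [(t, t * ternary c)] in the plane
   with the l1 distance; for [t = 0] the value of [leg] is junk. The metric space
   is kept abstract because unification would unfold its neighborhoods. *)
Section fan_space.
Context {R : realType} (l : cantor_space -> R).

Record fan_model := FanModel {
  profile01 : forall c, 0 <= l c <= 1;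
  profile_usc :
    forall c e, 0 < e -> exists k, forall d, agree k c d -> l d < l c + e;
  fan_carrier :> metricType R;
  height : fan_carrier -> R;
  leg : fan_carrier -> cantor_space;
  pt : cantor_space -> R -> fan_carrier;
  mdistE : forall x y, mdist x y = `|height x - height y| +
    `|height x * ternary (leg x) - height y * ternary (leg y)|;
  height_ge0 : forall x, 0 <= height x;
  height_le : forall x, 0 < height x -> height x <= l (leg x);
  height_pt : forall c t, 0 <= t <= l c -> height (pt c t) = t;
  leg_pt : forall c t, 0 < t <= l c -> leg (pt c t) = c
}.

Definition on_fan (x : cantor_space * R) : bool :=
  (x == (point, 0)) || (0 < x.2 <= l x.1).

Definition fan : Type := {x : cantor_space * R | on_fan x}.

HB.instance Definition _ := Choice.copy fan {x : cantor_space * R | on_fan x}.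

Let leg0 (x : fan) : cantor_space := (\val x).1.
Let height0 (x : fan) : R := (\val x).2.

Let fan_dist (x y : fan) : R := `|height0 x - height0 y| +
  `|height0 x * ternary (leg0 x) - height0 y * ternary (leg0 y)|.

Let height0_ge0 x : 0 <= height0 x.
Proof.
by case: x => -[c t] /=; rewrite /on_fan /height0/= => /predU1P[[_ ->]//|/andP[/ltW]].
Qed.

Let height0_eq x y : height0 x = 0 -> height0 y = 0 -> x = y.
Proof.
suff h0 z : height0 z = 0 -> \val z = (point, 0).
  by move=> /h0 x0 /h0 y0; apply: val_inj; rewrite x0 y0.
case: z => -[c t] /=; rewrite /on_fan /height0/= => /predU1P[//|/andP[+ _]] t0.
by rewrite t0 ltxx.
Qed.

Let fan_ext x y : height0 x = height0 y -> leg0 x = leg0 y -> x = y.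
Proof.
by case: x y => -[c s] p [[d t] q] st cd; apply: val_inj; congr pair.
Qed.

Let fan_distxx x : fan_dist x x = 0.
Proof. by rewrite /fan_dist !subrr normr0 addr0. Qed.

Let fan_dist_eq0 x y : fan_dist x y = 0 -> x = y.
Proof.
move=> /eqP; rewrite /fan_dist paddr_eq0// !normr_eq0 => /andP[].
rewrite subr_eq0 => /eqP xy; rewrite -xy -mulrBr mulf_eq0 => /predU1P[x0|].
  by apply: height0_eq; rewrite -?xy.
by rewrite subr_eq0 => /eqP/ternary_inj; exact: fan_ext.
Qed.

Let fan_distC x y : fan_dist x y = fan_dist y x.
Proof. by rewrite /fan_dist distrC; congr (_ + _); rewrite distrC. Qed.

Let fan_dist_triangle y x z : fan_dist x z <= fan_dist x y + fan_dist y z.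
Proof. by rewrite /fan_dist addrACA lerD// ler_distD. Qed.

HB.instance Definition _ := isMetric.Build R fan
  fan_distxx fan_dist_eq0 fan_distC fan_dist_triangle.

Let on_fan_base : on_fan (point, 0). Proof. by rewrite /on_fan eqxx. Qed.

Let base : fan := exist _ (point, 0) on_fan_base.

Let pt0 c t : fan := insubd base (c, t).

Let height0_le x : 0 < height0 x -> height0 x <= l (leg0 x).
Proof.
case: x => -[c t] /=; rewrite /on_fan /height0 /leg0/= => /predU1P[[_ ->]|/andP[]//].
by rewrite ltxx.
Qed.

Let height0_base c : height0 (pt0 c 0) = 0.
Proof. by rewrite /pt0 /insubd /height0; case: insubP => //= u _ ->. Qed.

Let height0_pt0 c t : 0 <= t <= l c -> height0 (pt0 c t) = t.
Proof.
case/andP; rewrite le_eqVlt => /predU1P[<- _|t0 tl]; first exact: height0_base.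
by rewrite /height0 val_insubd /on_fan /= t0 tl orbT.
Qed.

Let leg0_pt0 c t : 0 < t <= l c -> leg0 (pt0 c t) = c.
Proof. by move=> t0l; rewrite /leg0 val_insubd /on_fan /= t0l orbT. Qed.

Lemma fan_model_exists : (forall c, 0 <= l c <= 1) ->
  (forall c e, 0 < e -> exists k, forall d, agree k c d -> l d < l c + e) ->
  inhabited fan_model.
Proof.
move=> l01 usc.
exists; exact: (@FanModel l01 usc fan height0 leg0 pt0 (fun _ _ => erefl)
  height0_ge0 height0_le height0_pt0 leg0_pt0).
Qed.

End fan_space.

Section fan_theory.
Context {R : realType} (l : cantor_space -> R) (X : fan_model l).
Implicit Types (x y : X) (c d : cantor_space).

Let l01 := profile01 X.
Let l_ge0 c : 0 <= l c. Proof. by case/andP: (l01 c). Qed.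
Let l_le1 c : l c <= 1. Proof. by case/andP: (l01 c). Qed.

Lemma height_inj0 x y : height x = 0 -> height y = 0 -> x = y.
Proof.
by move=> x0 y0; apply: mdist_positivity;
  rewrite mdistE x0 y0 !mul0r !subrr normr0 addr0.
Qed.

Lemma fan_ext x y : height x = height y -> leg x = leg y -> x = y.
Proof.
by move=> xy cd; apply: mdist_positivity; rewrite mdistE xy cd !subrr normr0 addr0.
Qed.

Definition vertex : X := pt X point 0.

Lemma near_mdist x e : 0 < e -> nbhs x [set y | mdist x y < e].
Proof. by move=> e0; have := nbhsx_ballx x e e0; rewrite ballEmdist. Qed.

Lemma nbhs_mdistP x (P : set X) :
  nbhs x P <-> exists2 e, 0 < e & forall y, mdist x y < e -> P y.
Proof.
split=> [/nbhs_ballP[e /= e0 eP]|[e e0 eP]].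
  by exists e => // y xy; apply: eP; rewrite ballEmdist.
by apply: filterS (near_mdist x e0) => y; exact: eP.
Qed.

Lemma cvg_mdist {T : Type} (F : set_system T) (FF : Filter F) (f : T -> X) x :
  (forall e, 0 < e -> \forall y \near F, mdist x (f y) < e) -> f @ F --> x.
Proof.
by move=> fx P /nbhs_mdistP[e /fx fe eP]; apply: filterS fe => y; exact: eP.
Qed.

Lemma height_continuous : continuous (@height R l X).
Proof.
move=> x; apply/cvgrPdist_lt => e /(near_mdist x); apply: filterS => y.
by apply: le_lt_trans; rewrite mdistE lerDl.
Qed.

Lemma slope_continuous : continuous (fun x => height x * ternary (leg x)).
Proof.
move=> x; apply/cvgrPdist_lt => e /(near_mdist x); apply: filterS => y.
by apply: le_lt_trans; rewrite mdistE lerDr.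
Qed.

Lemma ternary_leg_continuous x :
  0 < height x -> {for x, continuous (fun y => ternary (leg y) : R)}.
Proof.
move=> x0; have c :
    {for x, continuous (fun y => height y * ternary (leg y) / height y)}.
  apply: cvgM; first exact: (@slope_continuous x).
  apply: cvgV; [by rewrite gt_eqF | exact: (@height_continuous x)].
have {}c : (height y * ternary (leg y) / height y) @[y --> x] -->
    (ternary (leg x) : R).
  move: c; rewrite /prop_for /continuous_at /=.
  by rewrite mulrAC divff ?mul1r// gt_eqF.
apply: cvg_trans c; apply: near_eq_cvg.
have := @height_continuous x; move/cvgrPdist_lt => /(_ _ x0); apply: filterS => y.
rewrite ltr_distlC subrr => /andP[y0 _].
by rewrite mulrAC divff ?mul1r// gt_eqF.
Qed.

Lemma near_agree_leg x k :
  0 < height x -> \forall y \near x, agree k (leg x) (leg y).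
Proof.
move=> /ternary_leg_continuous/cvgrPdist_lt/(_ (3^-1 ^+ k)).
rewrite exprn_gt0 ?invr_gt0// => /(_ isT); apply: filterS => y.
exact: ternary_agree.
Qed.

Lemma near_height_gt0 x : 0 < height x -> \forall y \near x, 0 < height y.
Proof.
move=> x0; have := @height_continuous x.
move/cvgrPdist_lt => /(_ _ x0); apply: filterS => y.
by rewrite ltr_distlC subrr => /andP[].
Qed.

Lemma height_vertex : height vertex = 0. Proof. by rewrite height_pt// lexx l_ge0. Qed.

Lemma height_eq0 x : height x = 0 -> x = vertex.
Proof. by move=> x0; apply: height_inj0; rewrite ?height_vertex. Qed.

Lemma height_gt0 x : x <> vertex -> 0 < height x.
Proof.
move=> xv; rewrite lt_neqAle height_ge0 andbT eq_sym; apply/eqP.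
by move/height_eq0.
Qed.

Lemma pt0 c : pt X c 0 = vertex.
Proof.
by apply: height_eq0; rewrite height_pt// lexx l_ge0.
Qed.

Lemma ptK x : pt X (leg x) (height x) = x.
Proof.
case: (pselect (x = vertex)) => [->|/height_gt0 x0].
  by rewrite height_vertex pt0.
have xl := height_le x0; apply: fan_ext; first by rewrite height_pt// ltW.
by rewrite leg_pt// x0.
Qed.

Lemma height_ternary_pt c t : 0 <= t <= l c ->
  height (pt X c t) * ternary (leg (pt X c t)) = t * ternary c.
Proof.
move=> tl; rewrite height_pt//; case/andP: tl.
rewrite le_eqVlt => /predU1P[<-|t0 tl]; first by rewrite !mul0r.
by rewrite leg_pt// t0.
Qed.

Lemma mdist_pt c d s t : 0 <= s <= l c -> 0 <= t <= l d ->
  mdist (pt X c s) (pt X d t) = `|s - t| + `|s * ternary c - t * ternary d|.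
Proof. by move=> sc td; rewrite mdistE !height_ternary_pt// !height_pt. Qed.

Lemma mdist_pt_le c d s t : 0 <= s <= l c -> 0 <= t <= l d -> t <= 1 ->
  mdist (pt X c s) (pt X d t) <= 2 * `|s - t| + `|ternary c - ternary d|.
Proof.
move=> sc td t1; rewrite mdist_pt// mulr_natl mulr2n -addrA lerD2l.
have -> : s * ternary c - t * ternary d =
    (s - t) * ternary c + t * (ternary c - ternary d) by ring.
rewrite (le_trans (ler_normD _ _))// !normrM lerD//.
  by rewrite ler_piMr// ger0_norm ?ternary_ge0 ?ternary_le1.
by rewrite ler_piMl// ger0_norm//; case/andP: td.
Qed.

Lemma height_leg x : 0 <= height x <= l (leg x).
Proof.
rewrite height_ge0/=; case: (pselect (x = vertex)) => [->|/height_gt0/height_le//].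
by rewrite height_vertex l_ge0.
Qed.

Lemma mdist_le_pt x d t : 0 <= t <= l d ->
  mdist x (pt X d t) <= 2 * `|height x - t| + `|ternary (leg x) - ternary d|.
Proof.
move=> td; rewrite -[in leLHS](ptK x); apply: mdist_pt_le => //.
  exact: height_leg.
by case/andP: td => _ /le_trans; exact.
Qed.

Definition clamp c t : R := Num.max 0 (Num.min t (l c)).

Lemma clamp_itv c t : 0 <= clamp c t <= l c.
Proof. by rewrite /clamp le_max lexx /= ge_max l_ge0 ge_min lexx orbT. Qed.

Lemma clamp_id c t : 0 <= t <= l c -> clamp c t = t.
Proof. by case/andP=> t0 tl; rewrite /clamp (min_idPl tl) (max_idPr t0). Qed.

Lemma pt_clamp_continuous c : continuous (fun t => pt X c (clamp c t)).
Proof.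
move=> t; apply: cvg_mdist => e e0.
have cc : continuous (clamp c : R -> R).
  move=> s; apply: (@continuous_max R R (fun=> 0) (fun t => Num.min t (l c))).
    exact: cvg_cst.
  apply: (@continuous_min R R id (fun=> l c)); [exact: cvg_id|exact: cvg_cst].
have e2 : 0 < e / 2 by rewrite divr_gt0.
have := cc t; move/cvgrPdist_lt => /(_ _ e2); apply: filterS => s ts.
have h u : 0 <= clamp c u <= l c by exact: clamp_itv.
apply: le_lt_trans (mdist_pt_le (h t) (h s) _) _.
  by apply: le_trans (l_le1 c); case/andP: (h s).
by rewrite subrr normr0 addr0; lra.
Qed.

Definition segment c s t : set X :=
  (fun u => pt X c (s + u * (t - s))) @` `[0, 1].

Lemma segment_point c s t u : 0 <= s <= l c -> 0 <= t <= l c ->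
  `[0, 1]%classic u -> 0 <= s + u * (t - s) <= l c.
Proof.
move=> /andP[s0 sc] /andP[t0 tc]; rewrite /= in_itv /= => /andP[u0 u1].
by apply/andP; split; nra.
Qed.

Lemma segment_arc c s t : 0 <= s <= l c -> 0 <= t <= l c -> s != t ->
  is_arc (segment c s t) (pt X c s) (pt X c t).
Proof.
move=> sc tc st; exists (fun u => pt X c (s + u * (t - s))); split; last 2 first.
  by rewrite mul0r addr0.
  by rewrite mul1r addrC subrK.
have ts : t - s != 0 by rewrite subr_eq0 eq_sym.
apply: (@homeomorphism_cancel _ _ _ _ _ (fun x => (height x - s) / (t - s))).
- by move=> u u01; exists u.
- move=> _ [u u01 <-]; rewrite height_pt; last exact: segment_point.
  by rewrite addrC addKr mulfK.
- move=> u u01; rewrite height_pt; last exact: segment_point.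
  by rewrite addrC addKr mulfK.
- move=> _ [u u01 <-]; rewrite height_pt; last exact: segment_point.
  by rewrite [in X in X / _]addrC addKr mulfK.
- apply: (@within_continuous_eq R X _ (fun u => pt X c (clamp c (s + u * (t - s))))).
    by move=> u u01; rewrite clamp_id//; exact: segment_point.
  apply: continuous_subspaceT => u.
  apply: (@continuous_comp R R X (fun u => s + u * (t - s)) (fun t => pt X c (clamp c t))).
    by apply: cvgD; [exact: cvg_cst|apply: cvgM; [exact: cvg_id|exact: cvg_cst]].
  exact: pt_clamp_continuous.
- apply: continuous_subspaceT => x; apply: cvgM; last exact: cvg_cst.
  apply: cvgB; last exact: cvg_cst.
  exact: height_continuous.
Qed.

End fan_theory.

Section fan_topology.
Context {R : realType} (l : cantor_space -> R) (X : fan_model l).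
Implicit Types (x y : X) (c d : cantor_space).

Let l01 := profile01 X.
Let l_usc := profile_usc X.

Lemma near_ternary c (e : R) : 0 < e ->
  \forall d \near c, `|ternary c - ternary d| < e.
Proof.
move=> e0; have := @cvg_expr R 3^-1.
rewrite ger0_norm ?invr_ge0// invf_lt1 ?ltr1n// => /(_ isT).
move=> /cvgrPdist_lt/(_ _ e0)[k _ /(_ k (leqnn k))]; rewrite /= sub0r normrN.
rewrite ger0_norm ?exprn_ge0 ?invr_ge0// => ke.
by apply/nbhs_cantorP; exists k => d /(@agree_ternary R)/le_lt_trans; exact.
Qed.

Let subgraph := [set ct : cantor_space * R | 0 <= ct.2 <= l ct.1].

Let subgraph_closed : closed subgraph.
Proof.
rewrite -openC openE => -[c t] /= nct.
case: (ltP t 0) => t0.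
  exists (setT, [set s | s < 0]) => /=.
    by split; [exact: filterT | exact: lt_nbhsl].
  by move=> -[d s] [_ /= s0]; rewrite /subgraph/= leNgt s0.
have lt : l c < t by rewrite ltNge; apply/negP => tl; apply: nct; rewrite /subgraph/= t0.
have [|k ck] := @l_usc c ((t - l c) / 2); first by rewrite divr_gt0// subr_gt0.
exists ([set d | agree k c d], [set s | l c + (t - l c) / 2 < s]) => /=.
  split; first by apply/nbhs_cantorP; exists k.
  by apply: lt_nbhsr; lra.
by move=> -[d s] [/= /ck ld ls]; rewrite /subgraph/= => /andP[_]; lra.
Qed.

Lemma fan_compact : compact [set: X].
Proof.
have -> : [set: X] = (fun ct => pt X ct.1 ct.2) @` subgraph.
  apply/seteqP; split => // x _; exists (leg x, height x) => /=.
    exact: height_leg.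
  exact: ptK.
apply: continuous_compact.
  apply: within_continuous_mdist => -[c t] e ct e0.
  have e3 : 0 < e / 3 by rewrite divr_gt0.
  exists ([set d | `|ternary c - ternary d| < e / 3],
          [set s | `|t - s| < e / 3]) => /=.
    split; first exact: near_ternary.
    exact: (nbhsx_ballx t).
  move=> -[d s] [/= cd ts] ds /=; apply: le_lt_trans (mdist_pt_le X ct ds _) _.
    by case/andP: ds => _ /le_trans; apply; case/andP: (l01 d).
  by rewrite (splitr e); lra.
have cT : compact ([set: cantor_space] `*` (`[0, 1]%classic : set R)).
  by apply: compact_setX; [exact: cantor_space_compact | exact: segment_compact].
apply: (subclosed_compact subgraph_closed cT).
move=> -[c t] /andP[/= t0 tl]; split => //=.
by rewrite in_itv /=; apply/andP; split => //; apply: le_trans tl _; case/andP: (l01 c).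
Qed.

Lemma fan_connected : connected [set: X].
Proof.
have -> : [set: X] = \bigcup_(c : cantor_space)
    ((fun t => pt X c (clamp l c t)) @` `[0, 1]).
  apply/seteqP; split => // x _; exists (leg x) => //.
  have xl := height_leg x; exists (height x).
    rewrite /= in_itv/=; apply/andP; split; first by case/andP: xl.
    case/andP: xl => _ /le_trans; apply.
    by case/andP: (l01 (leg x)).
  by rewrite clamp_id// ptK.
apply: bigcup_connected.
  exists (vertex X) => c _; exists 0; first by rewrite /= in_itv/= lexx ler01.
  by rewrite clamp_id ?pt0// lexx; case/andP: (l01 c).
move=> c _; apply: connected_continuous_connected.
  exact: segment_connected.
exact/continuous_subspaceT/pt_clamp_continuous.
Qed.

Lemma leg_continuous x : 0 < height x -> {for x, continuous (@leg R l X)}.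
Proof.
move=> x0 P /nbhs_cantorP[k kP].
by apply: filterS (near_agree_leg k x0) => y /kP.
Qed.

Let Cone := cone R cantor_space.
Let I01 := set_type [set` `[0%R, 1%R : R]].

Let to01 (t : R) : I01 := insubd (exist _ 0 (Defs.zero_in_itv R)) t.

Let to01K t : 0 <= t <= 1 -> \val (to01 t) = t.
Proof. move=> t01; rewrite val_insubd; case: ifP => // /negP[].
by apply: mem_set; rewrite /= in_itv. Qed.

Let height01 x : 0 <= height x <= 1.
Proof.
have /andP[-> /le_trans] := height_leg x; apply.
by case/andP: (l01 (leg x)).
Qed.

Let to_cone x : Cone := \pi_Cone (leg x, to01 (height x)).

Let cone_height (y : Cone) : R := \val (repr y).2.
Let cone_slope (y : Cone) : R := \val (repr y).2 * ternary (repr y).1.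

Let cone_heightE c (t : I01) : cone_height (\pi_Cone (c, t)) = \val t.
Proof.
have /eqmodP : \pi_Cone (repr (\pi_Cone (c, t))) = \pi_Cone (c, t).
  exact: reprK.
rewrite /cone_height /= => /orP[/eqP ->//|/andP[/eqP -> /eqP ->]//].
Qed.

Let cone_slopeE c (t : I01) :
  cone_slope (\pi_Cone (c, t)) = \val t * ternary c.
Proof.
have /eqmodP : \pi_Cone (repr (\pi_Cone (c, t))) = \pi_Cone (c, t).
  exact: reprK.
rewrite /cone_slope /= => /orP[/eqP ->//|/andP[/eqP -> /eqP ->]].
by rewrite !mul0r.
Qed.

Let cone_height_continuous : continuous cone_height.
Proof.
apply/quotient_continuous.
have -> : cone_height \o \pi_Cone = (\val : I01 -> R) \o snd.
  by apply/funext => -[c t]; exact: cone_heightE.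
move=> ct; apply: continuous_comp; first exact: cvg_snd.
exact: initial_continuous.
Qed.

Let cone_slope_continuous : continuous cone_slope.
Proof.
apply/quotient_continuous.
have -> : cone_slope \o \pi_Cone =
    (fun ct : cantor_space * I01 => \val ct.2 * ternary ct.1).
  by apply/funext => -[c t]; exact: cone_slopeE.
move=> ct; apply: cvgM.
  apply: (@continuous_comp _ _ _ snd (\val : I01 -> R)); first exact: cvg_snd.
  exact: initial_continuous.
apply: (@continuous_comp _ _ _ fst (@ternary R)); first exact: cvg_fst.
by apply/cvgrPdist_lt => e; exact: near_ternary.
Qed.

Let to01_height_continuous : continuous (fun x => to01 (height x)).
Proof.
apply: (@continuous_comp_initial _ _ _ (\val : I01 -> R)).
have -> : \val \o (fun x => to01 (height x)) = @height R l X.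
  by apply/funext => x; exact: to01K.
exact: height_continuous.
Qed.

Let to_cone_continuous : continuous to_cone.
Proof.
move=> x; case: (pselect (x = vertex X)) => [->|/height_gt0 x0].
  move=> U; rewrite nbhsE => -[V [oV Vv] VU].
  have V0 c : V (\pi_Cone (c, to01 (height (vertex X)))).
    suff <- : to_cone (vertex X) = \pi_Cone (c, to01 (height (vertex X))) by [].
    apply/eqmodP; rewrite /cone_rel /=.
    by rewrite to01K ?height01// height_vertex eqxx orbT.
  have /compact_near_coveringP near := cantor_space_compact.
  have H := near X (nbhs (vertex X))
    (fun y c => V (\pi_Cone (c, to01 (height y)))) _.
  have {H} : \forall y \near vertex X,
      [set: cantor_space] `<=` (fun c => V (\pi_Cone (c, to01 (height y)))).
    apply: H => c _.
    have oW : nbhs (c, to01 (height (vertex X))) (\pi_Cone @^-1` V).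
      by apply: (@pi_continuous _ Cone); apply: open_nbhs_nbhs.
    case: oW => -[A B] [/= cA vB] AB.
    exists (A, (fun x => to01 (height x)) @^-1` B) => /=.
      by split => //; exact: to01_height_continuous.
    by move=> -[d y] [/= dA yB]; exact: (AB (d, _)).
  apply: filterS => y Vy; apply: VU; exact: Vy.
apply: (@continuous_comp _ _ _
  (fun x => (leg x, to01 (height x)) : cone_cylinder R cantor_space)).
  have cl : leg y @[y --> x] --> leg x by exact: leg_continuous.
  exact: (cvg_pair cl (@to01_height_continuous x)).
exact: pi_continuous.
Qed.

Let to_cone_mdist x y : mdist x y =
  `|cone_height (to_cone x) - cone_height (to_cone y)| +
  `|cone_slope (to_cone x) - cone_slope (to_cone y)|.
Proof. by rewrite mdistE !cone_heightE !cone_slopeE !to01K. Qed.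

Let from_cone (y : Cone) : X := xget (vertex X) [set x | to_cone x = y].

Let to_coneK : cancel to_cone from_cone.
Proof.
move=> x; rewrite /from_cone; case: xgetP => [z _ /= zx|/(_ x) /= []//].
by apply: mdist_positivity; rewrite to_cone_mdist zx !subrr normr0 addr0.
Qed.

Lemma fan_cone_homeomorphism :
  exists (Y : set (cantor_fan R)) (f : X -> cantor_fan R),
    [/\ continuum Y, homeomorphism [set: X] Y f &
      f (vertex X) = cone_point R cantor_space].
Proof.
exists (range to_cone), to_cone; split; last 1 first.
- apply/eqmodP; rewrite /cone_rel /=.
  by rewrite to01K ?height01// height_vertex eqxx orbT.
- split.
    apply: continuous_compact; last exact: fan_compact.
    exact: continuous_subspaceT.
  apply: connected_continuous_connected; first exact: fan_connected.
  exact: continuous_subspaceT.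
- apply: (@homeomorphism_cancel _ _ _ _ _ from_cone) => //.
  + by move=> _ [x _ <-]; rewrite to_coneK.
  + exact: continuous_subspaceT.
  + apply: within_continuous_mdist => _ e [x _ <-] e0.
    have e2 : 0 < e / 2 by rewrite divr_gt0.
    near=> y => -[z _ zy].
    rewrite -[in X in mdist _ X]zy !to_coneK to_cone_mdist zy (splitr e) ltrD//.
      near: y; have := @cone_height_continuous (to_cone x).
      by move=> /cvgrPdist_lt; exact.
    near: y; have := @cone_slope_continuous (to_cone x).
    by move=> /cvgrPdist_lt; exact.
Unshelve. all: by end_near. Qed.

End fan_topology.

(** * Arcs and endpoints *)

Section orders.
Context {R : realType} {X : metricType R}.
Implicit Types (x y : X) (A B : set X).

Lemma order_at_least1P x : order_at_least x 1 <-> exists A y, is_arc A x y.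
Proof.
split=> [[A [Ax _]]|[A [y Axy]]]; first by exists (A ord0); exact: Ax.
exists (fun=> A); split=> [_|i j]; first by exists y.
by rewrite (ord1 i) (ord1 j) eqxx.
Qed.

Lemma order_at_least2P x : order_at_least x 2 <-> exists A B,
  [/\ exists y, is_arc A x y, exists y, is_arc B x y & A `&` B = [set x]].
Proof.
split=> [[A [Ax AB]]|[A [B [Ax Bx AB]]]].
  by exists (A ord0), (A ord_max); split => //; exact: AB.
exists (fun i => if i == ord0 then A else B); split=> [i|i j ij].
  by case: ifP.
case: (eqVneq i ord0) => i0; case: (eqVneq j ord0) => j0 //; last 2 first.
- by rewrite setIC.
- by case: i j ij i0 j0 => -[|[|//]] i [[|[|//]]] j.
by rewrite i0 j0 eqxx in ij.
Qed.

End orders.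

Section fan_arcs.
Context {R : realType} (l : cantor_space -> R) (X : fan_model l).
Implicit Types (x y : X) (c d : cantor_space) (A : set X).

Let l01 := profile01 X.
Let l_ge0 c : 0 <= l c. Proof. by case/andP: (l01 c). Qed.

Definition tip c : X := pt X c (l c).

Definition spoke c : set X := [set x | x = vertex X \/ leg x = c].

Lemma height_tip c : height (tip c) = l c.
Proof. by rewrite height_pt// l_ge0 lexx. Qed.

Lemma leg_tip c : 0 < l c -> leg (tip c) = c.
Proof. by move=> lc; rewrite leg_pt// lc lexx. Qed.

Lemma tip_neq_vertex c : 0 < l c -> tip c <> vertex X.
Proof.
by move=> + tv; rewrite -height_tip tv height_vertex ltxx.
Qed.

Lemma segment_full c : segment c 0 (l c) = spoke c.
Proof.
apply/seteqP; split=> [_ [u u01 <-]|x]; rewrite ?add0r ?subr0.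
  have /= : 0 <= u * l c <= l c.
    have := segment_point (l := l) (c := c) (s := 0) (t := l c).
    by rewrite lexx l_ge0 lexx => /(_ _ isT isT u01); rewrite add0r subr0.
  case/andP; rewrite [0 <= _]le_eqVlt => /predU1P[<- _|ul0 ull].
    by left; rewrite pt0.
  by right; rewrite leg_pt// ul0.
case=> [->|<-].
  exists 0; first by rewrite /= in_itv/= lexx ler01.
  by rewrite mul0r add0r pt0.
have := height_leg x; case/andP; rewrite le_eqVlt => /predU1P[/esym/height_eq0 ->|x0 xl].
  exists 0; first by rewrite /= in_itv/= lexx ler01.
  by rewrite mul0r add0r pt0.
have l0 := lt_le_trans x0 xl; exists (height x / l (leg x)).
  rewrite /= in_itv/= ler_pdivrMr// mul1r xl andbT.
  by rewrite divr_ge0// ltW.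
by rewrite add0r subr0 divfK ?gt_eqF// ptK.
Qed.

Lemma spoke_arc c : 0 < l c -> is_arc (spoke c) (vertex X) (tip c).
Proof.
move=> lc; rewrite -segment_full -(pt0 X c); apply: segment_arc.
- by rewrite lexx l_ge0.
- by rewrite l_ge0 lexx.
- by rewrite lt_eqF.
Qed.

Lemma path_in_leg (f : R -> X) a b : a <= b -> {within `[a, b], continuous f} ->
  (forall t, a <= t <= b -> f t <> vertex X) -> leg (f a) = leg (f b).
Proof.
move=> ab cf fv; apply: contrapT => fab.
pose h t : R := ternary (leg (f t)).
have ch : {within `[a, b], continuous h}.
  apply: (@within_continuous_comp X R R _ f (fun x => ternary (leg x))) cf => x.
  rewrite inE => -[t /= tab <-].
  apply: ternary_leg_continuous; apply: height_gt0; apply: fv.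
  by move: tab; rewrite in_itv.
have h_neq : h a != h b by apply/eqP => /ternary_inj.
have [y hy ny] : exists2 y, Num.min (h a) (h b) < y < Num.max (h a) (h b) &
    forall e, ternary e <> y.
  by case: (ltgtP (h a) (h b)) h_neq => // hlt _; exact: ternary_skips.
have /IVT : Num.min (h a) (h b) <= y <= Num.max (h a) (h b).
  by case/andP: hy => /ltW -> /ltW ->.
by move=> /(_ ab ch)[t _ /ny].
Qed.

Lemma path_in_leg_itv (f : R -> X) a b s t : {within `[a, b], continuous f} ->
  (forall t, a <= t <= b -> f t <> vertex X) ->
  a <= s <= b -> a <= t <= b -> leg (f s) = leg (f t).
Proof.
move=> cf fv sab tab; wlog st : s t sab tab / s <= t.
  by move=> H; case/orP: (le_total s t) => st; [|apply/esym]; exact: H.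
case/andP: sab tab => as_ sb /andP[at_ tb].
apply: path_in_leg => // [|u /andP[su ut]].
  apply: continuous_subspaceW cf => u /=; rewrite !in_itv/= => /andP[su ut].
  by rewrite (le_trans as_ su) (le_trans ut tb).
by apply: fv; rewrite (le_trans as_ su) (le_trans ut tb).
Qed.

Lemma path_height_IVT (f : R -> X) a b v : a <= b ->
  {within `[a, b], continuous f} ->
  Num.min (height (f a)) (height (f b)) <= v <=
    Num.max (height (f a)) (height (f b)) ->
  exists2 t, a <= t <= b & height (f t) = v.
Proof.
move=> ab cf v_in.
have ch : {within `[a, b], continuous (fun t => height (f t))}.
  by apply: (@within_continuous_comp X R R _ f (@height R l X)) cf => x _;
    exact: height_continuous.
by have [t] := IVT ab ch v_in; rewrite in_itv/=; exists t.
Qed.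

Lemma arc_vertex_tip A c : 0 < l c -> is_arc A (vertex X) (tip c) -> A = spoke c.
Proof.
move=> lc [f [[[fA fI fS] cf _] f0 f1]].
have fv t : 0 < t <= 1 -> f t <> vertex X.
  case/andP=> t0 t1 ftv; have : t = 0.
    apply: fI; rewrite ?f0 ?inE /= ?in_itv /= ?lexx ?ler01//.
    by rewrite (ltW t0) t1.
  by move=> tE; rewrite tE ltxx in t0.
have f_leg t : 0 < t <= 1 -> leg (f t) = c.
  move=> /andP[t0 t1]; rewrite -(leg_tip lc) -f1.
  apply: path_in_leg => // [|s /andP[ts s1]]; last first.
    by apply: fv; rewrite (lt_le_trans t0 ts).
  apply: continuous_subspaceW cf => u /=; rewrite !in_itv/= => /andP[tu ->].
  by rewrite (le_trans (ltW t0)).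
apply/seteqP; split=> x.
  move=> /fS[t /= + <-]; rewrite in_itv/= => /andP[].
  rewrite le_eqVlt => /predU1P[<- _|t0 t1]; first by rewrite f0; left.
  by right; apply: f_leg; rewrite t0.
have A0 : A (vertex X).
  by rewrite -f0; apply: fA; rewrite /= in_itv/= lexx ler01.
case=> [->//|xc]; case: (pselect (x = vertex X)) => [->//|/height_gt0 x0].
have [|t /andP[t0 t1] tx] := @path_height_IVT f 0 1 (height x) ler01 cf.
  rewrite f0 f1 height_vertex height_tip (min_idPl _)// (max_idPr _)//.
  by rewrite ltW//= -xc height_le.
have <- : f t = x.
  apply: fan_ext => //; rewrite xc; apply: f_leg; rewrite t1 andbT.
  rewrite lt_neqAle t0 andbT; apply/eqP => t00.
  by rewrite -tx -t00 f0 height_vertex ltxx in x0.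
by apply: fA; rewrite /= in_itv/= t0.
Qed.

Lemma arc_joining_tip c : 0 < l c -> arc_joining (vertex X) (tip c) = spoke c.
Proof.
move=> lc; rewrite /arc_joining; case: xgetP => [A _ /=|/(_ (spoke c)) /= []].
  exact: arc_vertex_tip.
exact: spoke_arc.
Qed.

Lemma arc_from_tip A c y : 0 < l c -> is_arc A (tip c) y ->
  exists2 s, 0 <= s < l c & forall t, s <= t <= l c -> A (pt X c t).
Proof.
move=> lc [f [[[fA fI _] cf _] f0 _]].
have inj s t : 0 <= s <= 1 -> 0 <= t <= 1 -> f s = f t -> s = t.
  by move=> s01 t01; apply: fI; rewrite inE /= in_itv.
have [b /andP[b0 b1] fv] : exists2 b, 0 < b <= 1 &
    forall t, 0 <= t <= b -> f t <> vertex X.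
  case: (pselect (exists2 t, 0 <= t <= 1 & f t = vertex X)); last first.
    move=> nv; exists 1; first by rewrite ltr01 lexx.
    by move=> t t01 tv; apply: nv; exists t.
  move=> [t /andP[t0 t1] tv].
  have {}t0 : 0 < t.
    rewrite lt_neqAle t0 andbT; apply/eqP => t00.
    by apply: (tip_neq_vertex lc); rewrite -tv -t00 f0.
  exists (t / 2); first by apply/andP; split; lra.
  move=> s /andP[s0 st] sv; suff : s = t by lra.
  by apply: inj; rewrite ?sv ?tv//; apply/andP; split; lra.
have cfb : {within `[0, b], continuous f}.
  apply: continuous_subspaceW cf => u /=; rewrite !in_itv/= => /andP[-> ub].
  exact: le_trans b1.
have f_leg t : 0 <= t <= b -> leg (f t) = c.
  move=> tb; rewrite -(leg_tip lc) -f0; apply: path_in_leg_itv cfb fv tb _.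
  by rewrite lexx ltW.
have fb : leg (f b) = c by apply: f_leg; rewrite lexx ltW.
have fbl : height (f b) <= l c.
  by rewrite -fb; have /andP[] := height_leg (f b).
exists (height (f b)).
  rewrite height_ge0 lt_neqAle fbl andbT; apply/eqP => hb.
  suff : 0 = b by move=> b00; rewrite -b00 ltxx in b0.
  apply: inj; [by rewrite lexx ler01|by rewrite (ltW b0) b1|].
  by rewrite f0; apply: fan_ext; rewrite ?height_tip// leg_tip.
move=> t /andP[bt tl]; have [|s /andP[s0 sb] st] := @path_height_IVT f 0 b t (ltW b0) cfb.
  by rewrite f0 height_tip (min_idPr fbl) (max_idPl fbl) bt.
have <- : f s = pt X c t.
  by rewrite -[LHS]ptK st f_leg// s0.
by apply: fA; rewrite /= in_itv/= s0 (le_trans sb).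
Qed.

Lemma tip_endpoint c : 0 < l c -> endpoints X (tip c).
Proof.
move=> lc; split.
  apply/order_at_least1P; exists (segment c (l c) 0), (pt X c 0).
  apply: segment_arc; first by rewrite l_ge0 lexx.
    by rewrite lexx l_ge0.
  by rewrite gt_eqF.
move=> /order_at_least2P[A [B [[y Ay] [z Bz] AB]]].
have [s /andP[s0 sl] sA] := arc_from_tip lc Ay.
have [t /andP[t0 tl] tB] := arc_from_tip lc Bz.
pose m := Num.max s t.
have ml : m < l c by rewrite /m gt_max sl tl.
have m0 : 0 <= m by rewrite /m le_max s0.
have : (A `&` B) (pt X c m).
  by split; [apply: sA|apply: tB]; rewrite (ltW ml) andbT /m le_max lexx ?orbT.
rewrite AB => /= mt; have := congr1 (@height R l X) mt.
by rewrite height_tip height_pt ?m0 ?ltW// => ml'; rewrite ml' ltxx in ml.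
Qed.

Lemma order_vertex c d : c <> d -> 0 < l c -> 0 < l d ->
  order_at_least (vertex X) 2.
Proof.
move=> cd lc ld; apply/order_at_least2P; exists (spoke c), (spoke d); split.
- by exists (tip c); exact: spoke_arc.
- by exists (tip d); exact: spoke_arc.
apply/seteqP; split=> x /=; last by move=> ->; split; left.
by move=> [[//|xc] [//|xd]]; case: cd; rewrite -xc -xd.
Qed.

Lemma order_interior x : 0 < height x < l (leg x) -> order_at_least x 2.
Proof.
move=> /andP[x0 xl]; set c := leg x in xl *; set t := height x in x0 xl *.
have tl : 0 <= t <= l c by rewrite !ltW.
apply/order_at_least2P; exists (segment c t 0), (segment c t (l c)).
have xE : x = pt X c t by rewrite ptK.
split.
- exists (pt X c 0); rewrite xE; apply: segment_arc => //.
    by rewrite lexx l_ge0.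
  by rewrite gt_eqF.
- exists (pt X c (l c)); rewrite xE; apply: segment_arc => //.
    by rewrite l_ge0 lexx.
  by rewrite lt_eqF.
apply/seteqP; split=> y /=; last first.
  move=> ->; split; exists 0; rewrite ?mul0r ?addr0//=;
    by rewrite in_itv/= lexx ler01.
have u0 u : 0 <= u <= 1 -> 0 <= t + u * (0 - t) <= l c.
  by move=> /andP[u0 u1]; apply/andP; split; nra.
have ul u : 0 <= u <= 1 -> 0 <= t + u * (l c - t) <= l c.
  by move=> /andP[? u1]; apply/andP; split; nra.
move=> [[u + uy] [v + vy]]; rewrite /= !in_itv/= => u01 v01.
have := congr1 (@height R l X) uy; have := congr1 (@height R l X) vy.
rewrite !height_pt ?u0 ?ul// => hv hu.
have yt : height y = t.
  apply/eqP; rewrite eq_le; apply/andP; split.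
    by rewrite -hu; case/andP: u01 => ? ?; nra.
  by rewrite -hv; case/andP: v01 => ? ?; nra.
by rewrite -uy hu yt.
Qed.

Lemma fan_endpoints c d : c <> d -> 0 < l c -> 0 < l d ->
  endpoints X = [set tip c | c in [set c | 0 < l c]].
Proof.
move=> cd lc ld; apply/seteqP; split=> [x [_ x2]|_ [e le <-]]; last first.
  exact: tip_endpoint.
have x0 : 0 < height x.
  by apply: height_gt0 => xv; apply: x2; rewrite xv; exact: (order_vertex cd).
have xl := height_le x0; exists (leg x); first exact: lt_le_trans xl.
rewrite -[RHS]ptK; congr pt; apply/eqP; rewrite eq_le xl andbT leNgt.
by apply/negP => xl'; apply: x2; apply: order_interior; rewrite x0.
Qed.

Lemma fan_smooth c d : c <> d -> 0 < l c -> 0 < l d -> smooth_fan (vertex X).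
Proof.
move=> cd lc ld; split.
- by split; [exact: fan_compact | exact: fan_connected].
- by exists (tip c), (vertex X); exact: tip_neq_vertex.
- exact: fan_cone_homeomorphism.
- exact: (order_vertex cd).
Qed.

End fan_arcs.

(** * Accumulation of endpoints *)

Section limit_heights.
Context {R : realType}.
Implicit Types (l : cantor_space -> R) (c d : cantor_space).

Definition limit_height l (S : set cantor_space) c t : Prop :=
  forall k e, 0 < e -> exists d, [/\ S d, agree k c d & `|l d - t| < e].

Context (l : cantor_space -> R) (X : fan_model l).
Implicit Types (x y : X).

Let l01 := profile01 X.
Let l_ge0 c : 0 <= l c. Proof. by case/andP: (l01 c). Qed.

Lemma near_tip c k (e : R) : 0 < l c -> 0 < e ->
  \forall y \near tip X c, agree k c (leg y) /\ `|height y - l c| < e.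
Proof.
move=> lc e0; near=> y; split; near: y.
  have := @near_agree_leg _ _ _ (tip X c) k; rewrite height_tip leg_tip//.
  exact.
have := @height_continuous _ _ _ (tip X c).
move=> /cvgrPdist_lt/(_ e e0); apply: filterS => y.
by rewrite height_tip distrC.
Unshelve. all: by end_near. Qed.

Lemma closure_tips (S : set cantor_space) x : 0 < height x ->
  (closure (tip X @` S) x <-> limit_height l S (leg x) (height x)).
Proof.
move=> x0; split=> [Sx k e e0|Sx B].
  have : \forall y \near x, agree k (leg x) (leg y) /\
      (0 < height y /\ `|height y - height x| < e).
    near=> y; split; first by near: y; exact: near_agree_leg.
    split; first by near: y; exact: near_height_gt0.
    near: y; have := @height_continuous _ _ _ x.
    by move=> /cvgrPdist_lt/(_ e e0); apply: filterS => y; rewrite distrC.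
  move=> /Sx[_ [[d Sd <-]]]; rewrite height_tip => -[xd [ld xe]].
  by exists d; split => //; move: xd; rewrite leg_tip.
move=> /nbhs_mdistP[e e0 eB]; have e3 : 0 < e / 3 by rewrite divr_gt0.
have /nbhs_cantorP[k kx] := @near_ternary R (leg x) _ e3.
have [d [Sd xd dx]] := Sx k _ e3.
exists (tip X d); split; first by exists d.
apply: eB; apply: le_lt_trans (mdist_le_pt _ _) _; first by rewrite l_ge0 lexx.
by have := kx d xd; rewrite distrC in dx; rewrite (splitr e); lra.
Unshelve. all: by end_near. Qed.

Lemma closure_tips_vertex (S : set cantor_space) :
  (forall e, 0 < e -> exists2 d, S d & l d < e) ->
  closure (tip X @` S) (vertex X).
Proof.
move=> Se B /nbhs_mdistP[e e0 eB].
have [|d Sd de] := Se (e / 3); first by rewrite divr_gt0.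
exists (tip X d); split; first by exists d.
apply: eB; rewrite mdistE height_vertex mul0r !sub0r !normrN height_tip.
have d0 := l_ge0 d; have t0 := @ternary_ge0 R (leg (tip X d)).
have t1 := @ternary_le1 R (leg (tip X d)).
rewrite !ger0_norm ?mulr_ge0//.
by have : l d * ternary (leg (tip X d)) <= l d; [rewrite ler_piMr|lra].
Qed.

Lemma closure_tips_vertexF (S : set cantor_space) e : 0 < e ->
  (forall d, S d -> e <= l d) -> ~ closure (tip X @` S) (vertex X).
Proof.
move=> e0 Se /(_ _ (near_mdist (vertex X) e0))[_ [[d /Se de <-]]] /=.
rewrite mdistE height_vertex mul0r !sub0r !normrN height_tip => /(le_lt_trans _).
move=> /(_ (l d)); rewrite (ger0_norm (l_ge0 d)) lerDl normr_ge0 => /(_ isT).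
by rewrite ltNge de.
Qed.

End limit_heights.

Section K_fan_criterion.
Context {R : realType} (l : cantor_space -> R) (X : fan_model l).
Context (K Kt : nat -> set R) (a : nat -> cantor_space).
Hypothesis a_inj : injective a.
Hypothesis la_gt0 : forall n, 0 < l (a n).

Let live := [set c | 0 < l c].

Let l01 := profile01 X.
Let l_ge0 c : 0 <= l c. Proof. by case/andP: (l01 c). Qed.

Let endpointsE : endpoints X = tip X @` live.
Proof.
have a01 : a 0%N <> a 1%N by move=> /a_inj.
exact: (fan_endpoints X a01).
Qed.

Lemma leg_traceP c x : 0 < l c -> leg_trace (vertex X) (tip X c) x <->
  [/\ leg x = c, 0 < height x < l c & limit_height l live c (height x)].
Proof.
move=> lc; rewrite /leg_trace arc_joining_tip// endpointsE; split.
  move=> [[xE xs] /not_orP[xv xt]]; case: xs => [//|xc].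
  have x0 := height_gt0 xv; split=> //; last first.
    by rewrite -xc; apply/closure_tips.
  rewrite x0 -xc lt_neqAle height_le// andbT; apply/eqP => xl; apply: xt.
  by apply: fan_ext; rewrite ?leg_tip// height_tip xl xc.
move=> [xc /andP[x0 xl] xlim]; split; first split.
- by apply/closure_tips; rewrite ?xc.
- by right.
- case=> [xv|xt]; first by rewrite xv height_vertex ltxx in x0.
  by rewrite xt height_tip ltxx in xl.
Qed.

Hypothesis Kt_iso : forall n, order_isomorphic (Kt n) (K n).
Hypothesis Kt_itv : forall n, Kt n `<=` `]0, 1[.
Hypothesis limit_a : forall n t, 0 < t < l (a n) ->
  (limit_height l live (a n) t <-> exists2 s, Kt n s & t = s * l (a n)).

Lemma leg_iso n :
  leg_order_isomorphic (vertex X) (tip X (a n))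
    (leg_trace (vertex X) (tip X (a n))) (K n).
Proof.
have ln := la_gt0 n; exists (fun x => height x / l (a n)).
have ln0 : l (a n) != 0 by rewrite gt_eqF.
have tl t : `[0, 1]%classic t -> 0 <= t * l (a n) <= l (a n).
  by rewrite /= in_itv/= => /andP[t0 t1]; apply/andP; split; nra.
split.
- rewrite arc_joining_tip//.
  apply: (@homeomorphism_cancel X R _ _ _ (fun t => pt X (a n) (t * l (a n)))).
  + move=> x xn; rewrite /= in_itv/= divr_ge0 ?height_ge0// ler_pdivrMr// mul1r.
    case: xn => [->|<-]; first by rewrite height_vertex l_ge0.
    by case/andP: (height_leg x).
  + move=> t /tl; rewrite [0 <= _]le_eqVlt => /andP[/predU1P[<- _|t0 t1]].
      by left; rewrite pt0.
    by right; rewrite leg_pt// t0.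
  + move=> x; rewrite divfK//.
    by move=> [->|<-]; rewrite ?ptK// height_vertex pt0.
  + by move=> t /tl tn; rewrite height_pt// mulfK.
  + apply: continuous_subspaceT => x; apply: cvgM; last exact: cvg_cst.
    exact: height_continuous.
  + apply: (@within_continuous_eq R X _
      (fun t => pt X (a n) (clamp l (a n) (t * l (a n))))).
      by move=> t /tl tn; rewrite clamp_id.
    apply: continuous_subspaceT => t.
    apply: (@continuous_comp R R X (fun t => t * l (a n))
      (fun t => pt X (a n) (clamp l (a n) t))).
      by apply: cvgM; [exact: cvg_id|exact: cvg_cst].
    exact: pt_clamp_continuous.
- by rewrite height_vertex mul0r.
- by rewrite height_tip divff.
suff -> : (fun x => height x / l (a n)) @` leg_trace (vertex X) (tip X (a n)) = Kt n.
  exact: Kt_iso.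
apply/seteqP; split=> [_ [x /leg_traceP[]// xn xl /limit_a[]// s Ks sx <-]|s Ks].
  by rewrite sx mulfK.
have := Kt_itv Ks; rewrite /= in_itv/= => /andP[s0 s1].
have sl : 0 < s * l (a n) < l (a n) by apply/andP; split; nra.
exists (pt X (a n) (s * l (a n))); last first.
  by rewrite height_pt ?mulfK//; case/andP: sl => /ltW-> /ltW->.
case/andP: sl => sl0 sl1.
apply/leg_traceP => //; rewrite leg_pt ?sl0 ?ltW// height_pt ?ltW ?sl0 ?ltW//.
by split => //; apply/limit_a; [rewrite sl0|exists s].
Qed.

Hypothesis limit_other : forall c t, 0 < l c -> ~ range a c -> 0 < t < l c ->
  ~ limit_height l live c t.
Hypothesis limit_top : forall c, 0 < l c -> ~ range a c ->
  limit_height l (range a) c (l c).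
Hypothesis K_neq0 : range a <> live -> forall n, K n <> set0.

Lemma K_fan_criterion : K_fan_with K (vertex X) (tip X \o a).
Proof.
have a01 : a 0%N <> a 1%N by move=> /a_inj.
have la := la_gt0.
have out x : (endpoints X `\` range (tip X \o a)) x ->
    exists2 c, 0 < l c /\ ~ range a c & x = tip X c.
  rewrite endpointsE => -[[c lc <-] na]; exists c => //; split=> //.
  by move=> [n _ nc]; apply: na; exists n; rewrite //= nc.
split.
- exact: (fan_smooth X a01).
- by move=> _ [n _ <-]; rewrite endpointsE; exists (a n) => //; exact: la_gt0.
- exact: leg_iso.
- move=> x /out[c [lc nac] ->] n [phi [_ _ _ [h [_ _]]]].
  have -> : leg_trace (vertex X) (tip X c) = set0.
    apply/seteqP; split=> // y /leg_traceP[]// yc yl ylim.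
    exact: (limit_other lc nac yl).
  rewrite !image_set0 => /esym; apply: K_neq0 => al; apply: nac.
  by rewrite al.
- move=> x /out[c [lc nac] ->]; exists (tip X c); split; last exact: tip_neq_vertex.
  split; last by rewrite arc_joining_tip//; right; rewrite leg_tip.
  have tc0 : 0 < height (tip X c) by rewrite height_tip.
  rewrite -(image_comp a (tip X)); apply: (closure_tips (range a) tc0).2.
  by rewrite height_tip leg_tip//; exact: limit_top.
Qed.

End K_fan_criterion.

(** * Binary expansions *)

Section binary_expansions.
Implicit Types (c d : cantor_space) (i j k n : nat).
Local Open Scope nat_scope.

Definition value k c : nat := \sum_(i < k) c i * 2 ^ i.

Definition bits n : cantor_space := fun i => odd (n %/ 2 ^ i).

Lemma value0 c : value 0 c = 0.
Proof. by rewrite /value big_ord0. Qed.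

Lemma valueS k c : value k.+1 c = value k c + c k * 2 ^ k.
Proof. by rewrite /value big_ord_recr. Qed.

Lemma agree_value k c d : agree k c d -> value k c = value k d.
Proof. by move=> cd; apply: eq_bigr => i _; rewrite cd. Qed.

Lemma value_lt k c : value k c < 2 ^ k.
Proof.
elim: k => [|k IH]; first by rewrite value0.
by rewrite valueS expnS; case: (c k); lia.
Qed.

Lemma value_le j k c : j <= k -> value j c <= value k c.
Proof.
move=> /subnK <-; elim: (k - j) => // n IH.
by rewrite addSn valueS (leq_trans IH)// leq_addr.
Qed.

Lemma value_ge i k c : i < k -> c i -> value i c + 2 ^ i <= value k c.
Proof.
by move=> /(value_le c); rewrite valueS => + ci; rewrite ci mul1n.
Qed.

Lemma value_const j k c : j <= k -> (forall i, j <= i < k -> ~~ c i) ->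
  value k c = value j c.
Proof.
move=> /subnK <-; elim: (k - j) => // n IH ci.
rewrite addSn valueS (negbTE (ci _ _)) ?mul0n ?addn0.
  by apply: IH => i /andP[ji ik]; apply: ci; rewrite ji ltnS ltnW.
by rewrite leq_addl addSn ltnS leqnn.
Qed.

Lemma bits_value k c i : bits (value k c) i = (i < k) && c i.
Proof.
rewrite /bits; elim: k => [|k IH]; first by rewrite value0 div0n.
rewrite valueS; have vk := value_lt k c.
case: (ltngtP i k) => [ik|ki|->]; last 1 first.
- rewrite addnC divnMDl ?expn_gt0// divn_small// ltnSn.
  by case: (c k).
- have -> : 2 ^ k = 2 ^ (k - i) * 2 ^ i by rewrite -expnD subnK// ltnW.
  rewrite ltnS (ltnW ik) /= addnC mulnA.
  rewrite divnMDl ?expn_gt0// oddD IH ik /= oddM oddX.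
  by rewrite subn_eq0 leqNgt ik /= andbF.
- rewrite ltnS leqNgt ki /= divn_small//.
  have : 2 ^ k.+1 <= 2 ^ i by rewrite leq_exp2l.
  by rewrite expnS; case: (c k); lia.
Qed.

Lemma value_bits_mod k n : value k (bits n) = n %% 2 ^ k.
Proof.
elim: k => [|k IH]; first by rewrite value0 modn1.
rewrite valueS IH /bits.
have := divn_eq n (2 ^ k); set q := n %/ 2 ^ k; set r := n %% 2 ^ k => nE.
have rk : r < 2 ^ k by rewrite ltn_mod expn_gt0.
have -> : n = q./2 * (2 * 2 ^ k) + (r + odd q * 2 ^ k).
  rewrite [LHS]nE -[in LHS](odd_double_half q) mulnDl -muln2 -mulnA.
  by rewrite -addnA addnC -addnA.
rewrite expnS modnMDl modn_small//.
by case: (odd q); lia.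
Qed.

Lemma value_bits n k : n <= k -> value k (bits n) = n.
Proof.
move=> nk; rewrite value_bits_mod modn_small//.
by rewrite (leq_trans (ltn_expl n (ltnSn 1)))// leq_exp2l.
Qed.

Lemma bits_inj : injective bits.
Proof.
move=> m n mn; rewrite -(@value_bits m (maxn m n)) ?leq_maxl//.
by rewrite mn value_bits// leq_maxr.
Qed.

Lemma bits_high n i : n <= i -> bits n i = false.
Proof.
move=> ni; rewrite /bits divn_small//.
by rewrite (leq_trans (ltn_expl n (ltnSn 1)))// leq_exp2l.
Qed.

Lemma agree_bits_value k c : agree k c (bits (value k c)).
Proof. by move=> i ik; rewrite bits_value ik. Qed.

Lemma bits_value_eq k c : (forall i, k <= i -> ~~ c i) -> bits (value k c) = c.
Proof.
move=> ck; apply/funext => i; rewrite bits_value.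
by case: ltnP => //= /ck/negbTE ->.
Qed.

Lemma not_bits_one c k : ~ range bits c -> exists2 i, k <= i & c i.
Proof.
move=> nc; apply: contrapT => ci; apply: nc; exists (value k c) => //.
by apply: bits_value_eq => i ki; apply/negP => cii; apply: ci; exists i.
Qed.

Lemma not_bits_value c N : ~ range bits c ->
  exists k, forall j, k <= j -> N <= value j c.
Proof.
move=> /(@not_bits_one _ N)[i Ni ci]; exists i.+1 => j ij.
have := value_ge ij ci; have := ltn_expl i (ltnSn 1); lia.
Qed.

Lemma bits_add n j : n <= j -> agree j (bits n) (bits (n + 2 ^ j)) /\
  (forall i, j <= i -> bits (n + 2 ^ j) i = (i == j)).
Proof.
move=> nj; pose c : cantor_space := fun i => bits n i || (i == j).
have cn : value j c = n.
  rewrite -[RHS](value_bits nj); apply: agree_value => i ij.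
  by rewrite /c (ltn_eqF ij) orbF.
have -> : bits (n + 2 ^ j) = c.
  have -> : n + 2 ^ j = value j.+1 c by rewrite valueS cn /c eqxx orbT mul1n.
  apply: bits_value_eq => i ji; rewrite /c bits_high ?(leq_trans nj (ltnW ji))//=.
  by rewrite gtn_eqF.
split=> [i ij|i ji]; first by rewrite /c (ltn_eqF ij) orbF.
by rewrite /c bits_high// (leq_trans nj).
Qed.

End binary_expansions.

(** * Height profiles *)

Section profiles.
Context {R : realType} (m : pred nat) (q : nat -> nat -> R).
Hypothesis q01 : forall n k, 0 <= q n k <= 1.
Implicit Types (c d : cantor_space) (i j k n : nat).

Definition factor c j : R := if m j && c j then q (value j c) j else 1.

Definition partial_height k c : R := \prod_(j < k) factor c j.

Definition profile c : R := inf (range (partial_height ^~ c)).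

Lemma partial_height0 c : partial_height 0 c = 1.
Proof. by rewrite /partial_height big_ord0. Qed.

Lemma partial_heightS k c :
  partial_height k.+1 c = partial_height k c * factor c k.
Proof. by rewrite /partial_height big_ord_recr. Qed.

Lemma factor01 c j : 0 <= factor c j <= 1.
Proof. by rewrite /factor; case: ifP => // _; rewrite ler01 lexx. Qed.

Lemma partial_height01 k c : 0 <= partial_height k c <= 1.
Proof.
elim: k => [|k /andP[p0 p1]]; first by rewrite partial_height0 ler01 lexx.
have /andP[f0 f1] := factor01 c k.
by rewrite partial_heightS mulr_ge0//= mulr_ile1.
Qed.

Lemma agree_partial_height k c d :
  agree k c d -> partial_height k c = partial_height k d.
Proof.
move=> cd; apply: eq_bigr => i _; rewrite /factor cd//.
by rewrite (agree_value (agree_le (ltnW (ltn_ord i)) cd)).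
Qed.

Lemma partial_height_le j k c :
  (j <= k)%N -> partial_height k c <= partial_height j c.
Proof.
move=> /subnK <-; elim: (k - j)%N => // n IH; rewrite addSn partial_heightS.
apply: le_trans IH; have /andP[f0 f1] := factor01 c (n + j).
by have /andP[p0 p1] := partial_height01 (n + j) c; rewrite ler_piMr.
Qed.

Lemma profile_le k c : profile c <= partial_height k c.
Proof.
apply: ge_inf; last by exists k.
by exists 0 => _ [j _ <-]; case/andP: (partial_height01 j c).
Qed.

Lemma le_profile c x : (forall k, x <= partial_height k c) -> x <= profile c.
Proof.
move=> xc; apply: lb_le_inf; first by exists (partial_height 0 c); exists 0%N.
by move=> _ [k _ <-].
Qed.

Lemma le_profile_from k c x :
  (forall j, (k <= j)%N -> x <= partial_height j c) -> x <= profile c.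
Proof.
move=> xc; apply: le_profile => j; case: (leqP k j) => [/xc//|/ltnW jk].
by apply: le_trans (xc k (leqnn k)) _; exact: partial_height_le.
Qed.

Lemma profile_01 c : 0 <= profile c <= 1.
Proof.
rewrite le_profile/=; last by move=> k; case/andP: (partial_height01 k c).
by have := profile_le 0 c; rewrite partial_height0.
Qed.

Lemma profile_near c e : 0 < e -> exists k, partial_height k c < profile c + e.
Proof.
move=> e0; apply: contrapT => nk.
suff : profile c + e <= profile c by rewrite leNgt ltrDl e0.
apply: le_profile => k; rewrite leNgt; apply/negP => kc; apply: nk.
by exists k.
Qed.

Lemma profile_is_usc c e : 0 < e ->
  exists k, forall d, agree k c d -> profile d < profile c + e.
Proof.
move=> /(profile_near c)[k kc]; exists k => d cd.
by apply: le_lt_trans kc; rewrite (agree_partial_height cd) profile_le.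
Qed.

Lemma profile_const k c :
  (forall i, (k <= i)%N -> ~~ (m i && c i)) -> profile c = partial_height k c.
Proof.
move=> ci; apply/eqP; rewrite eq_le profile_le/=.
apply: (@le_profile_from k) => j /subnK <-; elim: (j - k)%N => // n IH.
by rewrite addSn partial_heightS /factor (negbTE (ci _ _)) ?leq_addl// mulr1.
Qed.

Lemma profile_bits_value k c : profile (bits (value k c)) = partial_height k c.
Proof.
rewrite (@profile_const k); last first.
  by move=> i ki; rewrite bits_value ltnNge ki /= andbF.
by rewrite -(agree_partial_height (@agree_bits_value k c)).
Qed.

Lemma profile_bits n k :
  (n <= k)%N -> profile (bits n) = partial_height k (bits n).
Proof. by move=> nk; rewrite -[in LHS](value_bits nk) profile_bits_value. Qed.

Lemma partial_height_next n j : (n <= j)%N -> m j ->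
  partial_height j.+1 (bits (n + 2 ^ j)) = profile (bits n) * q n j.
Proof.
move=> nj mj; have [nd dj] := bits_add nj.
rewrite partial_heightS -(agree_partial_height nd) -(profile_bits nj).
by rewrite /factor mj dj// eqxx/= -(agree_value nd) value_bits.
Qed.

Lemma profile_next n j : (n <= j)%N -> m j ->
  profile (bits (n + 2 ^ j)) = profile (bits n) * q n j.
Proof.
move=> nj mj; rewrite -partial_height_next//; apply: profile_const => i ji.
have [_ ->] := bits_add nj; last exact: ltnW.
by rewrite gtn_eqF// andbF.
Qed.

Lemma limit_height_next n t : 0 < profile (bits n) -> 0 < t ->
  (forall k e, 0 < e -> exists j, [/\ (k <= j)%N, m j & `|q n j - t| < e]) ->
  limit_height profile [set c | 0 < profile c] (bits n) (t * profile (bits n)).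
Proof.
move=> ln t0 qt k e e0.
have [|j [kj mj jt]] := qt (maxn k n) (Num.min e t); first by rewrite lt_min e0.
move: kj; rewrite geq_max => /andP[kj nj]; exists (bits (n + 2 ^ j)).
move: jt; rewrite lt_min => /andP[je jt]; split.
- by rewrite /= profile_next// mulr_gt0//; move: jt; rewrite ltr_distl subrr => /andP[].
- by apply: (agree_le kj); case: (bits_add nj).
- rewrite profile_next// mulrC -mulrBl normrM (gtr0_norm ln).
  by have /andP[_ l1] := profile_01 (bits n); apply: le_lt_trans je; rewrite ler_piMr.
Qed.

Lemma limit_height_top c : 0 < profile c ->
  limit_height profile (bits @` [set n | 0 < profile (bits n)]) c (profile c).
Proof.
move=> c0 k e e0; have [j jc] := profile_near c e0.
pose i := maxn j k; exists (bits (value i c)); rewrite profile_bits_value.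
have ci := profile_le i c; split.
- exists (value i c) => //=; rewrite profile_bits_value.
  exact: lt_le_trans ci.
- by apply: (agree_le _ (@agree_bits_value i c)); rewrite leq_maxr.
- rewrite ger0_norm ?subr_ge0// ltrBlDl; apply: le_lt_trans jc.
  by apply: partial_height_le; rewrite leq_maxl.
Qed.

Lemma first_one k c : (exists2 i, (k <= i)%N & c i) ->
  exists j, [/\ (k <= j)%N, c j & forall i, (k <= i < j)%N -> ~~ c i].
Proof.
move=> [i ki ci]; have ex : exists i, (k <= i)%N && c i by exists i; rewrite ki.
exists (ex_minn ex); case: ex_minnP => j /andP[kj cj] jmin; split=> //.
move=> a /andP[ka aj]; apply/negP => ca.
by have := jmin a; rewrite ka ca leqNgt aj => /(_ isT).
Qed.

Lemma first_one_bits n k d : (n <= k)%N -> agree k (bits n) d -> d <> bits n ->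
  exists j, [/\ (k <= j)%N, d j, value j d = n & agree j (bits n) d].
Proof.
move=> nk nd dn; have dk : value k d = n by rewrite -(agree_value nd) value_bits.
have [|j [kj dj jmin]] := @first_one k d.
  apply: contrapT => di; apply: dn; rewrite -dk bits_value_eq// => i ki.
  by apply/negP => dii; apply: di; exists i.
have jn : value j d = n by rewrite (value_const kj).
by exists j; split => //; rewrite -jn; apply/agree_sym/agree_bits_value.
Qed.

End profiles.

Section limits_of_heights.
Context {R : realType} (m : pred nat) (q : nat -> nat -> R).
Hypothesis q01 : forall n k, 0 <= q n k <= 1.
Context (Kt : nat -> set R).
Hypothesis Kt_closed : forall n, closed (Kt n).
Hypothesis q_in : forall n k, 0 < q n k -> Kt n (q n k).
Implicit Types (c d : cantor_space) (i j k n : nat).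

Let h : R := 2^-1.
Let h0 : 0 < h. Proof. by rewrite invr_gt0. Qed.
Let h1 : h < 1. Proof. by rewrite invf_lt1 ?ltr1n. Qed.

Local Notation l := (profile m q).
Local Notation live := [set c | 0 < l c].

Lemma half_exp_small (e : R) : 0 < e ->
  exists N, forall n, (N <= n)%N -> 2^-1 ^+ n < e.
Proof.
move=> e0; have := @cvg_expr R 2^-1.
rewrite ger0_norm ?invr_ge0// invf_lt1 ?ltr1n// => /(_ isT).
move=> /cvgrPdist_lt/(_ _ e0)[k _ kP]; exists k => n /kP /=.
by rewrite sub0r normrN ger0_norm ?exprn_ge0 ?invr_ge0.
Qed.

Lemma half_exp_le a b : (a <= b)%N -> h ^+ b <= h ^+ a.
Proof.
by move=> ab; apply: ler_wiXn2l; rewrite ?(ltW h0)// invf_le1 ?ler1n.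
Qed.

Let closed_ratio n t : 0 < l (bits n) ->
  (forall e, 0 < e -> exists j, 0 < q n j /\ `|l (bits n) * q n j - t| < e) ->
  exists2 s, Kt n s & t = s * l (bits n).
Proof.
move=> ln qt; exists (t / l (bits n)); last by rewrite divfK// gt_eqF.
apply: Kt_closed => B /nbhs_ballP[e /= e0 eB].
have [|j [qj jt]] := qt (e * l (bits n)); first by rewrite mulr_gt0.
exists (q n j); split; first exact: q_in.
apply: eB; rewrite -ball_normE /= -(ltr_pM2r ln).
rewrite -[X in _ * X < _](gtr0_norm ln) -normrM mulrBl divfK ?gt_eqF//.
by rewrite distrC [q n j * _]mulrC.
Qed.

Section small.
Hypothesis q_small : forall n k, q n k <= 2^-1 ^+ n.+1.

Lemma profile_dichotomy d k :
  (forall i, (k <= i)%N -> ~~ (m i && d i)) /\ l d = partial_height m q k d \/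
  l d <= h ^+ (value k d).+1.
Proof.
case: (pselect (exists2 i, (k <= i)%N & m i && d i)) => [[i ki mdi]|nd]; last first.
  have ni i : (k <= i)%N -> ~~ (m i && d i).
    by move=> ki; apply/negP => di; apply: nd; exists i.
  by left; split => //; exact: profile_const.
right; apply: le_trans (profile_le m q01 i.+1 d) _; rewrite partial_heightS.
rewrite /factor mdi; apply: (@le_trans _ _ (q (value i d) i)).
  by rewrite ler_piMl//; [case/andP: (q01 (value i d) i)
    |case/andP: (partial_height01 m q01 i d)].
apply: le_trans (q_small _ _) _; apply: half_exp_le.
by rewrite ltnS value_le.
Qed.

Lemma small_limit_node n t : 0 < t < l (bits n) ->
  limit_height l live (bits n) t -> exists2 s, Kt n s & t = s * l (bits n).
Proof.
move=> /andP[t0 tl] lim; apply: closed_ratio; first exact: lt_trans tl.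
move=> e e0; have [N hN] := @half_exp_small (t / 2) (divr_gt0 t0 (ltr0n _ 2)).
pose k := maxn n N.
have [|d [/= d0 nd]] := lim k (Num.min e (Num.min (t / 2) (l (bits n) - t))).
  by rewrite !lt_min e0 subr_gt0 tl divr_gt0.
rewrite !lt_min => /and3P[de dt dl].
have nk : (n <= k)%N by rewrite leq_maxl.
have ndn : l d != l (bits n).
  apply/eqP => dn; move: dl; rewrite dn ger0_norm ?ltxx// subr_ge0 ltW//.
have [|j [kj dj jn nj]] := first_one_bits nk nd.
  by move=> dn; rewrite dn eqxx in ndn.
have pj : partial_height m q j d = l (bits n).
  by rewrite -(agree_partial_height _ _ nj) -profile_bits// (leq_trans nk).
case: (profile_dichotomy d j.+1) => [[_ ldj]|]; last first.
  move=> /le_lt_trans/(_ (hN _ _)); rewrite valueS jn dj mul1n => dt2.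
  suff : l d < t / 2 by move: dt; rewrite ltr_distl => /andP[]; lra.
  apply: dt2; have := ltn_expl j (ltnSn 1).
  have : (N <= k)%N by rewrite leq_maxr.
  lia.
move: ldj; rewrite partial_heightS pj /factor dj andbT jn.
case: ifP => [mj ldj|_]; last by rewrite mulr1 => /eqP; rewrite (negbTE ndn).
exists j; rewrite -ldj; split => //.
have := d0; rewrite ldj pmulr_rgt0//; exact: lt_trans tl.
Qed.

Lemma small_live_tail c N : ~ range bits c -> 0 < l c -> exists k,
  (N <= value k c)%N /\ forall i, (k <= i)%N -> ~~ (m i && c i).
Proof.
move=> nc lc; have [M hM] := half_exp_small lc.
have [k kc] := @not_bits_value c (maxn M N) nc; exists k.
have := kc k (leqnn k); rewrite geq_max => /andP[Mk Nk]; split => //.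
case: (profile_dichotomy c k) => [[]//|].
by rewrite leNgt hM// ltnW.
Qed.

Lemma small_limit_other c t : 0 < l c -> ~ range bits c -> 0 < t < l c ->
  ~ limit_height l live c t.
Proof.
move=> lc nc /andP[t0 tl] lim.
have [N hN] := @half_exp_small (t / 2) (divr_gt0 t0 (ltr0n _ 2)).
have [k [Nk kc]] := small_live_tail N nc lc.
have [|d [/= d0 cd]] := lim k (Num.min (t / 2) (l c - t)).
  by rewrite lt_min subr_gt0 tl divr_gt0.
rewrite lt_min => /andP[dt dl].
case: (profile_dichotomy d k) => [[_ ld]|ld].
  move: dl; rewrite ld -(agree_partial_height _ _ cd) -(profile_const q01 kc).
  by rewrite ger0_norm ?ltxx// subr_ge0 ltW.
move: dt; rewrite ltr_distl => /andP[dt _].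
have : h ^+ (value k d).+1 < t / 2.
  by apply: hN; rewrite -(agree_value cd) ltnW.
lra.
Qed.

Lemma small_live_bits c : (forall i, m i) -> 0 < l c -> range bits c.
Proof.
move=> mT lc; apply: contrapT => nc.
have [k [_ kc]] := small_live_tail 0 nc lc.
by have [i ki ci] := @not_bits_one _ k nc; have := kc i ki; rewrite mT ci.
Qed.

End small.

Section large.
Hypothesis q_large : forall n k, 1 - 2^-1 ^+ n.+2 <= q n k.

Lemma partial_height_ge k j d : (k <= j)%N ->
  partial_height m q k d * (1 - h ^+ (value k d).+1 + h ^+ (value j d).+1) <=
  partial_height m q j d.
Proof.
move=> /subnK <-; elim: (j - k)%N => [|n IH]; first by rewrite subrK mulr1.
rewrite addSn partial_heightS; set i := (n + k)%N in IH *.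
have /andP[p0 p1] := partial_height01 m q01 k d.
have kv : h ^+ (value i d).+1 <= h ^+ (value k d).+1.
  by apply: half_exp_le; rewrite ltnS value_le// leq_addl.
rewrite /factor valueS; case: (boolP (d i)) => di; last first.
  by rewrite andbF mul0n addn0 mulr1.
rewrite andbT mul1n.
have vE : h ^+ (value i d + 2 ^ i).+1 <= h ^+ (value i d).+2.
  by apply: half_exp_le; rewrite ltnS -addn1 leq_add2l expn_gt0.
have vp : 0 < h ^+ (value i d).+1 by rewrite exprn_gt0.
have hS : h ^+ (value i d).+2 = h ^+ (value i d).+1 / 2 by rewrite exprSr.
have qi := q_large (value i d) i; have /andP[_ q1] := q01 (value i d) i.
case: ifP => _; last first.
  rewrite mulr1; apply: le_trans IH; rewrite ler_wpM2l// lerD2l; lra.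
apply: (le_trans _ (ler_wpM2r _ IH)); last by case/andP: (q01 (value i d) i).
rewrite -mulrA ler_wpM2l//.
have {}qi : 1 - h ^+ (value i d).+1 / 2 <= q (value i d) i by rewrite -hS.
have kp : h ^+ (value k d).+1 <= 1 by apply: exprn_ile1; exact: ltW.
nra.
Qed.

Lemma profile_partial k d :
  partial_height m q k d - h ^+ (value k d).+1 <= l d <= partial_height m q k d.
Proof.
rewrite profile_le// andbT; apply: (@le_profile_from _ _ _ q01 k) => j kj.
apply: le_trans (partial_height_ge d kj).
have /andP[p0 p1] := partial_height01 m q01 k d.
have vk : 0 < h ^+ (value k d).+1 by rewrite exprn_gt0.
have vj : 0 < h ^+ (value j d).+1 by rewrite exprn_gt0.
nra.
Qed.

Lemma large_profile_ge d : 2^-1 <= l d.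
Proof.
have := profile_partial 0 d; rewrite partial_height0 value0 expr1 => /andP[+ _].
by apply: le_trans; rewrite /h; lra.
Qed.

Lemma large_limit_node n t : 0 < t < l (bits n) ->
  limit_height l live (bits n) t -> exists2 s, Kt n s & t = s * l (bits n).
Proof.
move=> /andP[t0 tl] lim; apply: closed_ratio; first exact: lt_trans tl.
move=> e e0; pose e1 := Num.min (e / 2) ((l (bits n) - t) / 2).
have e10 : 0 < e1 by rewrite lt_min !divr_gt0// subr_gt0.
have [N hN] := half_exp_small e10.
pose k := maxn n N; have [d [/= d0 nd dt]] := lim k e1 e10.
have nk : (n <= k)%N by rewrite leq_maxl.
have [e1e e1t] : e1 <= e / 2 /\ e1 <= (l (bits n) - t) / 2.
  by rewrite /e1 !ge_min !lexx orbT.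
have [|j [kj dj jn nj]] := first_one_bits nk nd.
  by move=> dn; move: dt; rewrite dn ltr_distl => /andP[]; lra.
have pj : partial_height m q j d = l (bits n).
  by rewrite -(agree_partial_height _ _ nj) -profile_bits// (leq_trans nk).
have := profile_partial j.+1 d; rewrite partial_heightS pj /factor dj andbT jn.
have : h ^+ (value j.+1 d).+1 < e1.
  apply: hN; rewrite valueS jn dj mul1n; have := ltn_expl j (ltnSn 1).
  have : (N <= k)%N by rewrite leq_maxr.
  lia.
move: dt; rewrite ltr_distl => /andP[dt1 dt2] he; case: ifP => [mj|_] /andP[ld1 ld2].
  exists j; split; last by rewrite ltr_distl; apply/andP; split; lra.
  have := q_large n j; have : h ^+ n.+2 < 1; last by rewrite /h; lra.
  by apply: exprn_ilt1 => //; exact: ltW.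
by move: ld1; rewrite mulr1; lra.
Qed.

Lemma large_limit_other c t : ~ range bits c -> 0 < t < l c ->
  ~ limit_height l live c t.
Proof.
move=> nc /andP[t0 tl] lim; pose e := (l c - t) / 3.
have e0 : 0 < e by rewrite divr_gt0// subr_gt0.
have [N hN] := half_exp_small e0.
have [k kc] := not_bits_value N nc.
have [d [/= d0 cd dt]] := lim k e e0.
have := profile_partial k d; have := profile_partial k c.
rewrite -(agree_partial_height _ _ cd) -(agree_value cd).
have : h ^+ (value k c).+1 < e by apply: hN; rewrite ltnW// ltnS kc.
by move: dt; rewrite ltr_distl /e => /andP[? ?] ? /andP[? ?] /andP[? ?]; lra.
Qed.

End large.

End limits_of_heights.

(** * Rescaling compact sets *)

Section rescaling.
Context {R : realType}.
Implicit Types (K : set R) (x M e : R).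

Definition moebius M x : R := x / (x + M * (1 - x)).

Let moebius_denom M x : 0 < M -> 0 <= x <= 1 -> 0 < x + M * (1 - x).
Proof. by move=> M0 /andP[x0 x1]; nra. Qed.

Lemma moebius_itv M x : 0 < M -> 0 <= x <= 1 -> 0 <= moebius M x <= 1.
Proof.
move=> M0 x01; have d0 := moebius_denom M0 x01; case/andP: x01 => x0 x1.
by rewrite /moebius divr_ge0 ?(ltW d0)//= ler_pdivrMr// mul1r; nra.
Qed.

Lemma moebiusK M x : 0 < M -> 0 <= x <= 1 -> moebius M^-1 (moebius M x) = x.
Proof.
move=> M0 x01; have d0 := moebius_denom M0 x01.
rewrite /moebius; set d := x + _ in d0 *.
have -> : x / d + M^-1 * (1 - x / d) = d^-1.
  have : d != 0 by rewrite gt_eqF.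
  have : M != 0 by rewrite gt_eqF.
  by rewrite /d => Mn dn; field; rewrite Mn dn.
by rewrite invrK divfK// gt_eqF.
Qed.

Lemma moebius_le M x y : 0 < M -> 0 <= x <= 1 -> 0 <= y <= 1 -> x <= y ->
  moebius M x <= moebius M y.
Proof.
move=> M0 x01 y01 xy.
rewrite /moebius ler_pdivrMr ?moebius_denom// mulrAC ler_pdivlMr ?moebius_denom//.
by case/andP: x01 y01 => ? ? /andP[? ?]; nra.
Qed.

Lemma moebius_continuous M : 0 < M -> {within `[0, 1], continuous moebius M}.
Proof.
move=> M0; apply/subspace_continuousP => x; rewrite /= in_itv/= => x01.
apply: cvg_within_filter; apply: cvgM; first exact: cvg_id.
apply: cvgV; first by rewrite gt_eqF// moebius_denom.
apply: cvgD; first exact: cvg_id.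
apply: cvgM; first exact: cvg_cst.
by apply: cvgB; [exact: cvg_cst|exact: cvg_id].
Qed.

Let sub01 K : K `<=` `]0, 1[ -> forall x, K x -> 0 < x < 1.
Proof. by move=> K1 x /K1; rewrite /= in_itv. Qed.

Lemma moebius_iso M K : 0 < M -> K `<=` `]0, 1[ ->
  order_isomorphic (moebius M @` K) K.
Proof.
move=> M0 /sub01 K1; have M'0 : 0 < M^-1 by rewrite invr_gt0.
have i01 x : `[0, 1]%classic x -> 0 <= x <= 1 by rewrite /= in_itv.
exists (moebius M^-1); split.
- apply: (@homeomorphism_cancel R R _ _ _ (moebius M)).
  + by move=> x /i01 ?; rewrite /= in_itv/= moebius_itv.
  + by move=> x /i01 ?; rewrite /= in_itv/= moebius_itv.
  + by move=> x /i01 x01; rewrite -[X in moebius X](invrK M) moebiusK.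
  + by move=> x /i01 x01; rewrite moebiusK.
  + exact: moebius_continuous.
  + exact: moebius_continuous.
- by move=> x y; rewrite !in_itv/= => x01 y01; exact: moebius_le.
rewrite image_comp; apply/seteqP; split=> [_ [x Kx <-]|x Kx] /=.
  by rewrite moebiusK//; have /andP[/ltW-> /ltW->] := K1 x Kx.
by exists x => //=; rewrite moebiusK//; have /andP[/ltW-> /ltW->] := K1 x Kx.
Qed.

Lemma moebius_image_itv M K : 0 < M -> K `<=` `]0, 1[ ->
  moebius M @` K `<=` `]0, 1[.
Proof.
move=> M0 /sub01 K1 _ [x /K1 /andP[x0 x1] <-]; rewrite /= in_itv/= /moebius.
have d0 : 0 < x + M * (1 - x) by apply: moebius_denom => //; rewrite !ltW.
by rewrite divr_gt0//= ltr_pdivrMr// mul1r; nra.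
Qed.

Lemma moebius_image_compact M K : 0 < M -> compact K -> K `<=` `]0, 1[ ->
  compact (moebius M @` K).
Proof.
move=> M0 cK /sub01 K1; apply: continuous_compact => //.
apply: continuous_subspaceW (moebius_continuous M0) => x /K1 /andP[x0 x1].
by rewrite /= in_itv/= !ltW.
Qed.

Lemma compact_bounded_above K (f : R -> R) : compact K ->
  (forall x, K x -> {for x, continuous f}) ->
  exists2 B, 0 < B & forall x, K x -> f x <= B.
Proof.
move=> cK cf.
have : compact (f @` K).
  apply: continuous_compact => //; apply/subspace_continuousP => x Kx.
  by apply: cvg_within_filter; exact: cf.
move=> /compact_bounded[B [_ fB]].
exists (`|B| + 1) => [|x Kx]; first by rewrite ltr_wpDl.
apply: le_trans (ler_norm _) _; apply: (fB (`|B| + 1)); last by exists x.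
by rewrite (le_lt_trans (ler_norm B))// ltrDl.
Qed.

Lemma rescale_small K e : compact K -> K `<=` `]0, 1[ -> 0 < e ->
  exists Kt, [/\ order_isomorphic Kt K, compact Kt, Kt `<=` `]0, 1[ &
    forall x, Kt x -> x <= e].
Proof.
move=> cK K1 e0; have K01 := sub01 K1.
have [|B B0 BK] := @compact_bounded_above K (fun x => (1 - x)^-1) cK.
  move=> x /K01 /andP[x0 x1]; apply: cvgV; first by rewrite gt_eqF// subr_gt0.
  by apply: cvgB; [exact: cvg_cst|exact: cvg_id].
have M0 : 0 < B / e by rewrite divr_gt0.
exists (moebius (B / e) @` K); split.
- exact: moebius_iso.
- exact: moebius_image_compact.
- exact: moebius_image_itv.
move=> _ [x Kx <-]; have /andP[x0 x1] := K01 x Kx.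
rewrite /moebius ler_pdivrMr; last by rewrite moebius_denom// !ltW.
have := BK x Kx; rewrite -[_^-1]mul1r ler_pdivrMr ?subr_gt0// => B1.
have -> : e * (x + B / e * (1 - x)) = e * x + B * (1 - x).
  by field; rewrite gt_eqF.
nra.
Qed.

Lemma rescale_large K e : compact K -> K `<=` `]0, 1[ -> 0 < e ->
  exists Kt, [/\ order_isomorphic Kt K, compact Kt, Kt `<=` `]0, 1[ &
    forall x, Kt x -> 1 - e <= x].
Proof.
move=> cK K1 e0; have K01 := sub01 K1.
have [|B B0 BK] := @compact_bounded_above K (fun x => x^-1) cK.
  by move=> x /K01 /andP[x0 x1]; apply: cvgV; [rewrite gt_eqF|exact: cvg_id].
have M0 : 0 < e / B by rewrite divr_gt0.
exists (moebius (e / B) @` K); split.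
- exact: moebius_iso.
- exact: moebius_image_compact.
- exact: moebius_image_itv.
move=> _ [x Kx <-]; have /andP[x0 x1] := K01 x Kx.
rewrite /moebius ler_pdivlMr; last by rewrite moebius_denom// !ltW.
have := BK x Kx; rewrite -[_^-1]mul1r ler_pdivrMr// => B1.
have Bx : e / B <= e * x by rewrite ler_pdivrMr// -mulrA; nra.
set z := e / B * (1 - x); have z0 : 0 <= z by rewrite mulr_ge0 ?subr_ge0// ltW.
have zx : z <= e * x by apply: le_trans Bx; rewrite ler_piMr ?(ltW M0)// gerBl ltW.
have : 0 <= e * z by rewrite mulr_ge0// ltW.
rewrite mulrDr mulrBl mulrBl !mul1r; lra.
Qed.

Lemma dense_sequence K : K !=set0 -> exists s : nat -> R,
  (forall j, K (s j)) /\ forall x e k, K x -> 0 < e ->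
    exists j, [/\ (k <= j)%N, odd j & `|s j - x| < e].
Proof.
move=> [x0 Kx0].
pose near_point (p : rat * nat) :=
  xget x0 (K `&` [set y | `|y - ratr p.1| < p.2.+1%:R^-1]).
have near_pointK p : K (near_point p).
  by rewrite /near_point; case: xgetP => [y _ []|].
pose t i := if unpickle i is Some p then near_point p else x0.
exists (fun j => t (logn 2 j.+1).-1); split=> [j|x e k Kx e0].
  by rewrite /t; case: unpickle.
have [n ne] : exists n, n.+1%:R^-1 < e / 2.
  have [n] := @ltr_add_invr R 0 (e / 2) (divr_gt0 e0 (ltr0n _ 2)).
  by rewrite add0r; exists n.
have n0 : (0 : R) < n.+1%:R^-1 by rewrite invr_gt0.
have [r] : exists r : rat, ratr r \in `]x - n.+1%:R^-1, x + n.+1%:R^-1[.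
  by apply: rat_in_itvoo; rewrite ltrD2l gtrN.
rewrite in_itv/= => /andP[r1 r2].
pose i := pickle (r, n).
exists (2 ^ i.+1 * k.*2.+1).-1.
have p0 : (0 < 2 ^ i.+1)%N by rewrite expn_gt0.
have pk0 : (0 < 2 ^ i.+1 * k.*2.+1)%N by rewrite muln_gt0 p0.
split.
- rewrite -ltnS prednK//; nia.
- by rewrite -subn1 oddB// oddM oddX.
rewrite prednK// lognM// pfactorK//.
have -> : logn 2 k.*2.+1 = 0%N.
  by apply/eqP; rewrite lognE /= dvdn2 /= odd_double.
rewrite addn0 /= /t pickleK /near_point /=.
move: ne n0 r1 r2; set v : R := n.+1%:R^-1 => ne n0 r1 r2.
case: xgetP => [y -> [_ /=]|/(_ x) []].
  rewrite ltr_distl => /andP[y1 y2]; rewrite ltr_distl; apply/andP; split; lra.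
by split => //=; rewrite ltr_distl; apply/andP; split; lra.
Qed.

End rescaling.

(** * Fans with prescribed accumulation *)

Section node_data.
Context {R : realType}.

Definition node_data (K Kt : set R) (q : nat -> R) : Prop :=
  [/\ order_isomorphic Kt K, closed Kt, Kt `<=` `]0, 1[,
      forall j, (K = set0 -> q j = 0) /\ (K <> set0 -> Kt (q j)) &
      forall x e k, Kt x -> 0 < e ->
        exists j, [/\ (k <= j)%N, odd j & `|q j - x| < e]].

Lemma order_isomorphic_refl (A : set R) : A `<=` `[0, 1] -> order_isomorphic A A.
Proof.
move=> A01; exists id; split => //; last by rewrite image_id.
by apply: (@homeomorphism_cancel R R _ _ _ id) => //;
  apply: continuous_subspaceT => x; exact: cvg_id.
Qed.

Lemma node_data_exists (K : set R) (P : R -> Prop) :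
  (exists Kt, [/\ order_isomorphic Kt K, compact Kt, Kt `<=` `]0, 1[ &
    forall x, Kt x -> P x]) ->
  exists Kt q, node_data K Kt q /\ forall x, Kt x -> P x.
Proof.
move=> [Kt [iso cK K1 KP]]; have iso0 : Kt = set0 <-> K = set0.
  case: iso => h [_ _ <-]; split=> [->|]; first by rewrite image_set0.
  by move=> /seteqP[h0 _]; apply/seteqP; split=> // x Ktx; apply: (h0 (h x)); exists x.
have clK : closed Kt by apply: compact_closed cK; exact: Rhausdorff.
case: (pselect (K = set0)) => [K0|K0].
  by exists Kt, (fun=> 0); split=> //; split => // x e k; have /iso0 -> := K0.
have [|s [sK sd]] := @dense_sequence R Kt; first by apply/set0P/eqP => /iso0.
by exists Kt, s; split=> //; split => // j; split=> [/K0//|_]; exact: sK.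
Qed.

End node_data.

Section small_fans.
Context {R : realType} (m : pred nat) (K' : nat -> set R).
Context (Kt : nat -> set R) (q : nat -> nat -> R).
Hypothesis m_odd : forall j, odd j -> m j.
Hypothesis data : forall n, node_data (K' n) (Kt n) (q n).
Hypothesis Kt_small : forall n x, Kt n x -> x <= 2^-1 ^+ n.+1.

Local Notation l := (profile m q).
Local Notation live := [set c | 0 < l c].

Lemma node_gt0 n j : K' n <> set0 -> 0 < q n j.
Proof.
move=> K0; have [_ _ K1 /(_ j)[_ /(_ K0)/K1 qj] _] := data n.
by move: qj; rewrite /= in_itv/= => /andP[].
Qed.

Lemma node_eq0 n j : K' n = set0 -> q n j = 0.
Proof. by move=> K0; have [_ _ _ /(_ j)[/(_ K0) qj _] _] := data n. Qed.

Lemma node_in n j : 0 < q n j -> Kt n (q n j).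
Proof.
move=> q0; have [_ _ _ /(_ j)[_ Kq] _] := data n.
by apply: Kq => /(@node_eq0 _ j) qE; rewrite qE ltxx in q0.
Qed.

Lemma node01 n j : 0 <= q n j <= 1.
Proof.
case: (pselect (K' n = set0)) => [/(@node_eq0 _ j) ->|/(@node_gt0 _ j) q0].
  by rewrite lexx ler01.
have [_ _ K1 _ _] := data n; have := K1 _ (node_in q0).
by rewrite /= in_itv/= => /andP[/ltW -> /ltW ->].
Qed.

Lemma node_small n j : q n j <= 2^-1 ^+ n.+1.
Proof.
case: (pselect (K' n = set0)) => [/(@node_eq0 _ j) ->|/(@node_gt0 _ j) q0].
  by rewrite exprn_ge0// invr_ge0.
exact/Kt_small/node_in.
Qed.

Lemma node_limit n t : 0 < l (bits n) -> Kt n t ->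
  limit_height l live (bits n) (t * l (bits n)).
Proof.
move=> ln Kt_t; have [_ _ K1 _ qd] := data n.
apply: (limit_height_next node01) => // [|k e e0].
  by have := K1 t Kt_t; rewrite /= in_itv/= => /andP[].
have [j [kj oj jt]] := qd t e k Kt_t e0; exists j; split=> //.
exact: m_odd.
Qed.

Section nodes.
Context (s : nat -> nat).
Hypothesis s_inj : injective s.
Hypothesis s_live : forall n, 0 < l (bits (s n)).
Hypothesis s_surj : forall n, 0 < l (bits n) -> range s n.

Lemma range_nodes : range (bits \o s) = bits @` [set n | 0 < l (bits n)].
Proof.
apply/seteqP; split=> [_ [n _ <-]|_ [n ln <-]];
  first by exists (s n); [exact: s_live|].
by have [k _ <-] := s_surj ln; exists k.
Qed.

Lemma small_K_fan (X : fan_model l) (K : nat -> set R) :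
  (forall n, K n = K' (s n)) ->
  (range (bits \o s) <> live -> forall n, K n <> set0) ->
  K_fan_with K (vertex X) (tip X \o (bits \o s)).
Proof.
move=> KE K_neq0.
have notin c : 0 < l c -> ~ range (bits \o s) c -> ~ range bits c.
  by move=> lc nc [n _ nE]; apply: nc; rewrite range_nodes; exists n; rewrite //= nE.
apply: (@K_fan_criterion _ _ X K (Kt \o s)) => //.
- by apply: inj_comp => //; exact: bits_inj.
- by move=> n; rewrite KE; have [] := data (s n).
- by move=> n; have [] := data (s n).
- move=> n t tl; split=> [|[u Ku ->]]; last exact: node_limit.
  apply: (small_limit_node node01) => //; last exact: node_small.
    by move=> k; have [] := data k.
  exact: node_in.
- move=> c t lc /(notin c lc) nc tl; apply: (small_limit_other node01) => //.
  exact: node_small.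
- by move=> c lc _; rewrite range_nodes; apply: (limit_height_top node01).
Qed.

End nodes.

Lemma small_isolated c d k : (forall i, (k <= i)%N -> ~~ (m i && c i)) ->
  agree k c d -> `|l d - l c| < l c / 2 ->
  (forall i, (k <= i)%N -> ~~ (m i && d i)) /\ l d = l c.
Proof.
move=> ck cd dc; have lc := profile_const node01 ck.
have nd i : (k <= i)%N -> ~~ (m i && d i).
  move=> ki; apply/negP => mdi; have := profile_le m node01 i.+1 d.
  have pi := partial_height_le m node01 d ki.
  rewrite partial_heightS /factor mdi => ldi.
  have : q (value i d) i <= 2^-1.
    apply: le_trans (node_small _ _) _; rewrite exprS ler_piMr ?invr_ge0//.
    by rewrite exprn_ile1 ?invr_ge0// invf_le1 ?ler1n.
  have /andP[q0 _] := node01 (value i d) i.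
  have /andP[p0 _] := partial_height01 m node01 i d.
  move: pi; rewrite -(agree_partial_height m q cd) -lc => pi qi.
  move: dc; rewrite ltr_distl => /andP[dc _].
  by have : partial_height m q i d * q (value i d) i <= l c * 2^-1; [nra|lra].
split=> //; rewrite lc (profile_const node01 nd).
by rewrite (agree_partial_height m q cd).
Qed.

End small_fans.

Section positive.
Context {R : realType} (m : pred nat) (q : nat -> nat -> R).
Hypothesis q01 : forall n k, 0 <= q n k <= 1.

Lemma partial_height_gt0 k (c : cantor_space) :
  (forall j, (j < k)%N -> m j -> c j -> 0 < q (value j c) j) ->
  0 < partial_height m q k c.
Proof.
elim: k => [_|k IH qk]; first by rewrite partial_height0.
rewrite partial_heightS mulr_gt0//.
  by apply: IH => j jk; apply: qk; rewrite ltnS ltnW.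
by rewrite /factor; case: ifP => // /andP[mk ck]; exact: qk.
Qed.

Lemma profile_bits_gt0 n : (forall j, m j -> bits n j ->
  0 < q (value j (bits n)) j) -> 0 < profile m q (bits n).
Proof.
move=> qn; rewrite (profile_bits m q01 (leqnn n)); apply: partial_height_gt0.
by move=> j _; exact: qn.
Qed.

End positive.

Section node_families.
Context {R : realType} (K' : nat -> set R).
Hypothesis K'_compact : forall n, compact (K' n).
Hypothesis K'_sub : forall n, K' n `<=` `]0, 1[.

Lemma node_family (P : nat -> R -> Prop) :
  (forall n, exists Kt, [/\ order_isomorphic Kt (K' n), compact Kt,
    Kt `<=` `]0, 1[ & forall x, Kt x -> P n x]) ->
  exists Kt q, (forall n, node_data (K' n) (Kt n) (q n)) /\
    forall n x, Kt n x -> P n x.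
Proof.
move=> KtP.
have /choice[f fP] : forall n, exists Ktq : set R * (nat -> R),
    node_data (K' n) Ktq.1 Ktq.2 /\ forall x, Ktq.1 x -> P n x.
  by move=> n; have [Kt [q ?]] := node_data_exists (KtP n); exists (Kt, q).
exists (fun n => (f n).1), (fun n => (f n).2).
by split=> n; have [] := fP n.
Qed.

Lemma small_node_family : exists Kt q,
  (forall n, node_data (K' n) (Kt n) (q n)) /\
  forall n x, Kt n x -> x <= 2^-1 ^+ n.+1.
Proof.
apply: node_family => n; apply: rescale_small => //.
by rewrite exprn_gt0// invr_gt0.
Qed.

Lemma large_node_family : exists Kt q,
  (forall n, node_data (K' n) (Kt n) (q n)) /\
  forall n x, Kt n x -> 1 - 2^-1 ^+ n.+2 <= x.
Proof.
apply: node_family => n; apply: rescale_large => //.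
by rewrite exprn_gt0// invr_gt0.
Qed.

End node_families.

Lemma profile_fan {R : realType} m (q : nat -> nat -> R) :
  (forall n k, 0 <= q n k <= 1) -> inhabited (fan_model (profile m q)).
Proof.
move=> q01; apply: fan_model_exists => [c|c e].
  exact: profile_01.
exact: profile_is_usc.
Qed.

Section all_marked.
Context {R : realType} (K' : nat -> set R).
Hypothesis K'_compact : forall n, compact (K' n).
Hypothesis K'_sub : forall n, K' n `<=` `]0, 1[.

Lemma K_fan_nodes (K : nat -> set R) (s : nat -> nat) : injective s ->
  (forall n, K n = K' (s n)) ->
  (forall q : nat -> nat -> R, (forall n k, 0 <= q n k <= 1) ->
     (forall n j, K' n <> set0 -> 0 < q n j) ->
     (forall n j, K' n = set0 -> q n j = 0) ->
     forall n, 0 < profile xpredT q (bits n) <-> range s n) ->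
  exists (X : metricType R) (p : X) (e : nat -> X),
    [/\ K_fan_with K p e, homeomorphic (endpoints X) [set: nat] &
      endpoints X = range e].
Proof.
move=> s_inj KE live_s.
have [Kt [q [data small]]] := small_node_family K'_compact K'_sub.
have q01 := node01 data; have qs := node_small data small.
have [X] := profile_fan xpredT q01.
have {}live_s n : 0 < profile xpredT q (bits n) <-> range s n.
  by apply: live_s => // k j; [exact: node_gt0|exact: node_eq0].
have s_live n : 0 < profile xpredT q (bits (s n)) by apply/live_s; exists n.
have liveE : range (bits \o s) = [set c | 0 < profile xpredT q c].
  apply/seteqP; split=> [_ [n _ <-]|c /= c0]; first exact: s_live.
  have [n _ nc] := small_live_bits q01 qs (fun=> isT) c0.
  by move: c0; rewrite -nc => /live_s[k _ <-]; exists k.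
have bs_inj : injective (bits \o s) by apply: inj_comp => //; exact: bits_inj.
have endE : endpoints X = range (tip X \o (bits \o s)).
  have s01 : (bits \o s) 0%N <> (bits \o s) 1%N by move=> /bs_inj.
  rewrite (fan_endpoints X s01 (s_live _) (s_live _)) -liveE.
  by rewrite (image_comp (bits \o s) (tip X)).
exists X, (vertex X), (tip X \o (bits \o s)); split => //.
  apply: (@small_K_fan _ xpredT K' Kt q) => //.
  by move=> n; case: (live_s n).
pose f (x : X) : nat := xget 0%N [set n | bits (s n) = leg x].
have fK n : f (tip X (bits (s n))) = n.
  rewrite /f; case: xgetP => [k _|/(_ n)] /=; rewrite leg_tip ?s_live//.
  by move=> /bits_inj/s_inj.
exists f; apply: (@homeomorphism_cancel X nat _ _ _ (tip X \o (bits \o s))).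
- by [].
- by rewrite endE => n _; exists n.
- by rewrite endE => _ [n _ <-] /=; rewrite fK.
- by move=> n _; exact: fK.
- apply: within_continuousI; rewrite endE => _ P [n _ <-] /=.
  rewrite fK => /nbhs_singleton Pn.
  have ln := s_live n.
  have l2 : 0 < profile xpredT q (bits (s n)) / 2 by rewrite divr_gt0.
  have := near_tip X (s n) ln l2; apply: filterS => y + [k _ ky].
  rewrite -ky /= height_tip leg_tip// fK => -[nk nkl].
  have nn i : (s n <= i)%N -> ~~ (xpredT i && bits (s n) i).
    by move=> /bits_high ->.
  have [kn _] := small_isolated data small nn nk nkl.
  suff -> : k = n by [].
  apply: s_inj; apply: bits_inj; apply/funext => i.
  case: (ltnP i (s n)) => [/nk //|sni].
  by rewrite (bits_high sni); have := kn i sni; case: bits.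
- apply: within_continuousI => n P _ Pn.
  have n1 : nbhs n [set n] by exact: discrete_set1.
  refine (@filterS _ (nbhs n) _ _ _ _ n1) => _ -> _.
  exact: nbhs_singleton Pn.
Qed.

End all_marked.

Section discrete_endpoints.
Context {R : realType} (K : nat -> set R).
Hypothesis K_compact : forall n, compact (K n).
Hypothesis K_sub : forall n, K n `<=` `]0, 1[.

Lemma K_fan_discrete : (forall n, K n <> set0) ->
  exists (X : metricType R) (p : X) (e : nat -> X),
    [/\ K_fan_with K p e, homeomorphic (endpoints X) [set: nat] &
      endpoints X = range e].
Proof.
move=> K0; apply: (K_fan_nodes K_compact K_sub (s := id)) => //.
move=> q q01 q_gt0 _ n; split=> [_|_]; first by exists n.
by apply: profile_bits_gt0 => // j _ _; exact/q_gt0/K0.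
Qed.

(* The empty set, if present, is attached to the node 1, which has no children;
   the other sets are attached to the even nodes. *)
Lemma K_fan_empty n0 : K n0 = set0 -> (forall n, n <> n0 -> K n <> set0) ->
  exists (X : metricType R) (p : X) (e : nat -> X), K_fan_with K p e.
Proof.
move=> K0 Kn0.
pose K' nu := if odd nu then set0 else K (bump n0 nu./2).
pose s n := if n == n0 then 1%N else (unbump n0 n).*2.
have K'_neq0 nu : ~~ odd nu -> K' nu <> set0.
  by move=> /negbTE ev; rewrite /K' ev; apply: Kn0; apply/eqP; rewrite eq_sym neq_bump.
have s_inj : injective s.
  move=> a b; rewrite /s; case: (eqVneq a n0) => [->|an];
    case: (eqVneq b n0) => [->|bn] //.
  - by move=> /(congr1 odd); rewrite odd_double.
  - by move=> /(congr1 odd); rewrite odd_double.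
  - move=> /double_inj ab; rewrite -(@unbumpK n0 a) ?inE//.
    by rewrite ab unbumpK// inE.
have KE n : K n = K' (s n).
  rewrite /s /K'; case: (eqVneq n n0) => [->//|nn0].
  by rewrite odd_double doubleK unbumpK// inE.
have K'_compact nu : compact (K' nu).
  by rewrite /K'; case: ifP => // _; exact: compact0.
have K'_sub nu : K' nu `<=` `]0, 1[.
  by rewrite /K'; case: ifP => // _; exact: sub0set.
have [|X [p [e [Ke _ _]]]] := K_fan_nodes K'_compact K'_sub s_inj KE; last first.
  by exists X, p, e.
move=> q q01 q_gt0 q_eq0 n.
have ev_value j : ~~ odd n -> ~~ odd (value j (bits n)).
  rewrite value_bits_mod; case: j => [|j]; first by rewrite modn1.
  rewrite -!dvdn2 => n2; rewrite /dvdn modn_dvdm//; last by rewrite expnS dvdn_mulr.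
split=> [ln|[k _ <-]].
  case: (boolP (odd n)) => on; last first.
    exists (bump n0 n./2) => //; rewrite /s eq_sym (negbTE (neq_bump _ _)) bumpK.
    by rewrite even_halfK.
  exists n0 => //; rewrite /s eqxx.
  apply: contrapT => n1; have n_gt1 : (1 < n)%N by case: n on n1 {ln ev_value} => [|[|]].
  have [j j0 bj] : exists2 j, (0 < j)%N & bits n j.
    apply: contrapT => nb; have /(congr1 (value n)) : bits n = bits 1.
      apply/funext => -[|i]; first by rewrite /bits !divn1.
      rewrite (@bits_high 1)//; apply/negP => bi; apply: nb; by exists i.+1.
    by rewrite value_bits// value_bits ?(ltnW n_gt1)// => nE; rewrite nE ltnn in n_gt1.
  have := profile_le xpredT q01 j.+1 (bits n).
  rewrite partial_heightS /factor bj q_eq0 ?mulr0 ?leNgt ?ln//.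
  rewrite /K' ifT//; rewrite value_bits_mod.
  have := divn_eq n (2 ^ j) => /(congr1 odd); rewrite on oddD oddM oddX.
  by rewrite (gtn_eqF j0) /= andbF.
apply: profile_bits_gt0 => // j _; rewrite /s; case: (eqVneq k n0) => [_|kn0].
  case: j => [|j]; last by rewrite (@bits_high 1).
  by move=> _; rewrite value0; apply/q_gt0/K'_neq0.
move=> _; apply/q_gt0/K'_neq0; rewrite value_bits_mod.
case: j => [|j]; first by rewrite modn1.
rewrite -dvdn2 /dvdn modn_dvdm; last by rewrite expnS dvdn_mulr.
by rewrite -muln2 modnMl.
Qed.

Lemma K_fan_exists :
  (forall m n, m <> n -> ~ order_isomorphic (K m) (K n)) ->
  exists (X : metricType R) (p : X), K_fan K p.
Proof.
move=> K_noniso; case: (pselect (exists n, K n = set0)) => [[n0 K0]|nK0].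
  have [|X [p [e Ke]]] := K_fan_empty K0; last by exists X, p, e.
  move=> n nn0 Kn; apply: (K_noniso _ _ nn0); rewrite Kn K0.
  by apply: order_isomorphic_refl; exact: sub0set.
have [|X [p [e [Ke _ _]]]] := K_fan_discrete; last by exists X, p, e.
by move=> n Kn; apply: nK0; exists n.
Qed.

End discrete_endpoints.

Section cantor_nat_endpoints.
Context {R : realType} (K : nat -> set R).
Hypothesis K_compact : forall n, compact (K n).
Hypothesis K_sub : forall n, K n `<=` `]0, 1[.
Hypothesis K_neq0 : forall n, K n <> set0.
Implicit Types c d : cantor_space.

Definition even_part c : cantor_space := fun i => c i.*2.
Definition odd_part c : cantor_space := fun i => c i.*2.+1.
Definition interleave c d : cantor_space :=
  fun i => if odd i then d i./2 else c i./2.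
Definition odd_number c : nat := xget 0%N [set w | bits w = odd_part c].

Lemma even_part_interleave c d : even_part (interleave c d) = c.
Proof.
by apply/funext => i; rewrite /even_part /interleave odd_double doubleK.
Qed.

Lemma odd_part_interleave c d : odd_part (interleave c d) = d.
Proof.
apply/funext => i.
by rewrite /odd_part /interleave /= odd_double /= uphalf_double.
Qed.

Lemma interleave_parts c : interleave (even_part c) (odd_part c) = c.
Proof.
apply/funext => i; rewrite /even_part /odd_part /interleave.
by case: ifP => oi; rewrite -[in RHS](odd_double_half i) oi.
Qed.

Lemma odd_number_bits c w : bits w = odd_part c -> odd_number c = w.
Proof.
rewrite /odd_number => wc; case: xgetP => [v _ /=|/(_ w)/(_ wc)//].
by rewrite -wc => /bits_inj.
Qed.

Lemma K_fan_cantor_nat :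
  exists (X : metricType R) (p : X) (e : nat -> X),
    [/\ K_fan_with K p e,
      homeomorphic (endpoints X) [set: cantor_space * nat] &
      forall x, (endpoints X `\` range e) x ->
        closure (endpoints X) `&` arc_joining p x = [set p; x]].
Proof.
have [Kt [q [data small]]] := small_node_family K_compact K_sub.
have q01 := node01 data; have qs := node_small data small.
have [X] := profile_fan odd q01.
pose l := profile odd q.
have q_gt0 n j : 0 < q n j by apply: (node_gt0 data).
have bits_live n : 0 < l (bits n) by apply: profile_bits_gt0.
have endE : endpoints X = tip X @` [set c | 0 < l c].
  have b01 : bits 0 <> bits 1 by move=> /bits_inj.
  exact: (fan_endpoints X b01).
have live_tail c : 0 < l c -> exists k, forall i, (k <= i)%N -> ~~ (odd i && c i).
  move=> lc; case: (pselect (range bits c)) => [[n _ <-]|nc].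
    by exists n => i ni; rewrite bits_high// andbF.
  by have [k [_ kc]] := small_live_tail q01 qs 0 nc lc; exists k.
have live_odd c : 0 < l c -> bits (odd_number c) = odd_part c.
  move=> /live_tail[k kc]; have E : bits (value k (odd_part c)) = odd_part c.
    apply: bits_value_eq => i ki; have := kc i.*2.+1.
    rewrite /= odd_double; apply; rewrite (leq_trans ki)// -addnn.
    by rewrite leqW// leq_addr.
  by rewrite (odd_number_bits E).
have interleave_tail c w i : (w.*2 <= i)%N -> ~~ (odd i && interleave c (bits w) i).
  rewrite /interleave => wi; case: (boolP (odd i)) => //= oi.
  by rewrite bits_high// -[w]doubleK half_leq.
have interleave_live c w : 0 < l (interleave c (bits w)).
  rewrite /l (profile_const q01 (interleave_tail c w)).
  by apply: partial_height_gt0.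
have KX : K_fan_with K (vertex X) (tip X \o (bits \o id)).
  by apply: (@small_K_fan _ odd K Kt q).
exists X, (vertex X), (tip X \o bits); split => //.
- pose f (x : X) : cantor_space * nat := (even_part (leg x), odd_number (leg x)).
  pose g (cw : cantor_space * nat) : X := tip X (interleave cw.1 (bits cw.2)).
  exists f; apply: (@homeomorphism_cancel X _ _ _ _ g) => //.
  + move=> [c w] _; rewrite endE; exists (interleave c (bits w)) => //.
    exact: interleave_live.
  + rewrite endE => _ [c lc <-]; rewrite /f /g leg_tip//=.
    by rewrite live_odd// interleave_parts.
  + move=> [c w] _; rewrite /f /g leg_tip/=; last exact: interleave_live.
    by rewrite even_part_interleave (@odd_number_bits _ w)// odd_part_interleave.
  + apply: within_continuousI; rewrite endE => _ P [c lc <-].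
    rewrite /f leg_tip// => -[[A B] [/= nA nB] AB].
    have [k kA] := (nbhs_cantorP _ _).1 nA; have Bc := nbhs_singleton nB.
    have [k' kc] := live_tail c lc.
    have l2 : 0 < l c / 2 by rewrite divr_gt0.
    have := near_tip X (maxn k.*2 k') lc l2; apply: filterS => y + [d ld dy].
    rewrite -dy leg_tip// height_tip => -[cd dl]; apply: AB; split=> /=.
      apply: kA => i ik; apply: cd; rewrite leq_max; apply/orP; left.
      by rewrite ltn_double.
    have cd' := agree_le (leq_maxr _ _) cd.
    have [dk _] := small_isolated data small kc cd' dl.
    suff -> : odd_number d = odd_number c by [].
    apply: odd_number_bits; rewrite live_odd//; apply/funext => i.
    rewrite /odd_part; case: (ltnP i.*2.+1 k') => [/cd' //|ki].
    have := kc _ ki; have := dk _ ki; rewrite /= odd_double /=.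
    by move=> /negbTE -> /negbTE ->.
  + apply: within_continuous_mdist => -[c w] e _ e0.
    have /nbhs_cantorP[k kc] := @near_ternary R (interleave c (bits w)) _ e0.
    pose n := maxn k w.*2.
    exists ([set d | agree n c d], [set w]).
      by split => /=; [apply/nbhs_cantorP; exists n|exact: discrete_set1].
    move=> [d _] [/= cd ->] _.
    have icd : agree n (interleave c (bits w)) (interleave d (bits w)).
      move=> i ni; rewrite /interleave; case: ifP => // _; apply: cd.
      by apply: leq_ltn_trans ni; rewrite leq_half_double -addnn leqW// leq_addr.
    have lE : profile odd q (interleave d (bits w)) =
        profile odd q (interleave c (bits w)).
      rewrite !(profile_const q01 (interleave_tail _ w)).
      by apply/esym/agree_partial_height; apply: (agree_le _ icd); rewrite leq_maxr.
    apply: le_lt_trans (mdist_le_pt _ _) _.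
      by rewrite lexx ltW.
    rewrite height_tip leg_tip; last exact: interleave_live.
    rewrite /= lE subrr normr0 mulr0 add0r; apply: kc.
    by apply: (agree_le _ icd); rewrite leq_maxl.
- move=> x; rewrite endE => -[[c lc <-] nc].
  have {}nc : ~ range bits c by move=> [n _ nE]; apply: nc; exists n; rewrite //= nE.
  rewrite arc_joining_tip//; apply/seteqP; split=> y.
    move=> [yE ys]; case: (pselect (y = vertex X)) => [->|yv]; first by left.
    right; case: ys => [//|yc]; have y0 := height_gt0 yv.
    have yl := height_le y0; rewrite yc in yl.
    apply: fan_ext; rewrite ?leg_tip// height_tip; apply/eqP.
    rewrite eq_le yl leNgt; apply/negP => yl'.
    apply: (small_limit_other q01 qs lc nc (t := height y)).
      by rewrite y0.
    by rewrite -yc; apply/closure_tips.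
  move=> [->|->]; split; last 2 first.
  + by apply: subset_closure; exists c.
  + by right; rewrite leg_tip.
  + apply: closure_tips_vertex => e e0.
    have [N hN] := half_exp_small e0.
    pose j := N.*2.+1; have Nj : (N <= j)%N by rewrite /j -addnn leqW// leq_addr.
    have oj : odd j by rewrite /j /= odd_double.
    exists (bits (N + 2 ^ j)); first exact: bits_live.
    rewrite /l profile_next//; apply: le_lt_trans (hN N.+1 (leqnSn N)).
    apply: le_trans (qs N j); rewrite ler_piMl//; first exact: ltW.
    by case/andP: (profile_01 odd q01 (bits N)).
  + by left.
Qed.

End cantor_nat_endpoints.

(** * Schemes indexed by sequences of natural numbers *)

Section schemes.
Implicit Types (s : seq nat) (a : nat -> nat).

Record scheme {T : topologicalType} (S : set T) (A : seq nat -> set T) : Prop := {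
  scheme_root : A [::] = S;
  scheme_sub : forall s n, A (rcons s n) `<=` A s;
  scheme_cover : forall s x, A s x -> exists n, A (rcons s n) x;
  scheme_disjoint : forall s x m n,
    A (rcons s m) x -> A (rcons s n) x -> m = n;
  scheme_branch : forall a, exists x, forall n, A (mkseq a n) x;
  scheme_open : forall s x, A s x -> \forall y \near x, S y -> A s y;
  scheme_base : forall a x P, (forall n, A (mkseq a n) x) -> nbhs x P ->
    exists n, A (mkseq a n) `<=` P
}.

Section scheme_codes.
Context {T : topologicalType} (S : set T) (A : seq nat -> set T).
Hypothesis SA : scheme S A.
Hypothesis hausT : hausdorff_space T.

Lemma scheme_point_unique a x y :
  (forall n, A (mkseq a n) x) -> (forall n, A (mkseq a n) y) -> x = y.
Proof.
move=> ax ay; apply: hausT => P Q xP yQ.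
have [n nP] := scheme_base SA ax xP.
by exists y; split; [exact/nP/ay | exact: nbhs_singleton yQ].
Qed.

Lemma scheme_codeP x : S x -> exists a, forall n, A (mkseq a n) x.
Proof.
move=> Sx; pose next s := xget 0%N [set n | A (rcons s n) x].
have next_in s : A s x -> A (rcons s (next s)) x.
  by move=> /(scheme_cover SA)[n sn]; rewrite /next; case: xgetP => [//|/(_ n)].
pose fix path n := if n is k.+1 then rcons (path k) (next (path k)) else [::].
exists (fun n => next (path n)) => n.
have -> : mkseq (fun n => next (path n)) n = path n.
  by elim: n => // n IH; rewrite mkseqS IH.
by elim: n => [|n IH] /=; [rewrite (scheme_root SA) | exact: next_in].
Qed.

Lemma scheme_code_unique a b x n : A (mkseq a n) x -> A (mkseq b n) x ->
  mkseq a n = mkseq b n.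
Proof.
elim: n => // n IH; rewrite !mkseqS => ax bx.
have E := IH (scheme_sub SA ax) (scheme_sub SA bx).
by rewrite E in ax *; rewrite (scheme_disjoint SA ax bx).
Qed.

End scheme_codes.

Lemma scheme_homeomorphic {T U : topologicalType} (S : set T) (S' : set U) A B :
  hausdorff_space T -> hausdorff_space U ->
  scheme S A -> scheme S' B -> homeomorphic S S'.
Proof.
move=> hT hU SA SB.
have transfer (V W : topologicalType) (E : set V) (F : set W) C D :
    scheme E C -> scheme F D -> exists f : V -> W, forall x, E x ->
      forall a, (forall n, C (mkseq a n) x) -> forall n, D (mkseq a n) (f x).
  move=> EC FD; have [y0 _] := scheme_branch FD id.
  have /choice[f fP] : forall x, exists y, E x -> forall a,
      (forall n, C (mkseq a n) x) -> forall n, D (mkseq a n) y.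
    move=> x; case: (pselect (E x)) => [Ex|nEx]; last by exists y0.
    have [a ax] := scheme_codeP EC Ex; have [y ay] := scheme_branch FD a.
    exists y => _ b bx n; rewrite (scheme_code_unique EC (bx n) (ax n)).
    exact: ay.
  by exists f.
have cont (V W : topologicalType) (E : set V) (F : set W) C D (f : V -> W) :
    scheme E C -> scheme F D -> (forall x, E x -> forall a,
      (forall n, C (mkseq a n) x) -> forall n, D (mkseq a n) (f x)) ->
    {within E, continuous f}.
  move=> EC FD fP; apply: within_continuousI => x P Ex fxP.
  have [a ax] := scheme_codeP EC Ex.
  have [n nP] := scheme_base FD (fP x Ex a ax) fxP.
  apply: filterS (scheme_open EC (ax n)) => y + Ey => /(_ Ey) ayn.
  have [b yb] := scheme_codeP EC Ey; apply: nP.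
  by rewrite (scheme_code_unique EC ayn (yb n)); exact: fP.
have [f fP] := transfer _ _ _ _ _ _ SA SB.
have [g gP] := transfer _ _ _ _ _ _ SB SA.
have fS x : S x -> S' (f x).
  move=> Sx; have [a ax] := scheme_codeP SA Sx.
  by rewrite -(scheme_root SB); exact: (fP x Sx a ax 0%N).
have gS y : S' y -> S (g y).
  move=> Sy; have [a ay] := scheme_codeP SB Sy.
  by rewrite -(scheme_root SA); exact: (gP y Sy a ay 0%N).
exists f; apply: (@homeomorphism_cancel _ _ _ _ _ g) => //.
- move=> x Sx; have [a ax] := scheme_codeP SA Sx.
  apply: (scheme_point_unique SA hT _ ax).
  by apply: gP; [exact: fS | exact: fP].
- move=> y Sy; have [a ay] := scheme_codeP SB Sy.
  apply: (scheme_point_unique SB hU _ ay).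
  by apply: fP; [exact: gS | exact: gP].
- exact: cont SA SB fP.
- exact: cont SB SA gP.
Qed.

End schemes.

Section irrational_scheme.
Context {R : realType}.
Implicit Types (x y z : R) (a b r : rat) (s : seq nat).

Definition squash x : R := x / (1 + `|x|).

Let unsquash y : R := y / (1 - `|y|).

Let denom_gt0 x : 0 < 1 + `|x|. Proof. by rewrite ltr_wpDr. Qed.

Lemma squash_itv x : -1 < squash x < 1.
Proof.
rewrite -ltr_norml normrM normfV (gtr0_norm (denom_gt0 x)).
by rewrite ltr_pdivrMr// mul1r ltrDr.
Qed.

Lemma squashK : cancel squash unsquash.
Proof.
move=> x; rewrite /unsquash /squash normrM normfV (gtr0_norm (denom_gt0 x)).
have n0 : 1 + `|x| != 0 by rewrite gt_eqF.
have -> : 1 - `|x| / (1 + `|x|) = (1 + `|x|)^-1 by field.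
by rewrite invrK divfK.
Qed.

Lemma unsquashK y : -1 < y < 1 -> squash (unsquash y) = y.
Proof.
rewrite -ltr_norml => y1; have d0 : 0 < 1 - `|y| by rewrite subr_gt0.
rewrite /unsquash /squash normrM normfV (gtr0_norm d0).
have n0 : 1 - `|y| != 0 by rewrite gt_eqF.
have -> : 1 + `|y| / (1 - `|y|) = (1 - `|y|)^-1 by field.
by rewrite invrK divfK.
Qed.

Lemma squash_continuous : continuous squash.
Proof.
move=> x; apply: cvgM; first exact: cvg_id.
apply: cvgV; first by rewrite gt_eqF.
by apply: cvgD; [exact: cvg_cst | apply: cvg_norm; exact: cvg_id].
Qed.

Let unsquash_continuous y : -1 < y < 1 -> {for y, continuous unsquash}.
Proof.
rewrite -ltr_norml => y1; apply: cvgM; first exact: cvg_id.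
apply: cvgV; first by rewrite gt_eqF// subr_gt0.
by apply: cvgB; [exact: cvg_cst | apply: cvg_norm; exact: cvg_id].
Qed.

Lemma irrational_squash x : irrational x -> forall r, squash x <> ratr r.
Proof.
move=> ix r xr; apply: ix; exists (r / (1 - `|r|)) => //.
by rewrite rmorphM fmorphV rmorphB rmorph1 /= ratr_norm -xr; exact: squashK.
Qed.

Lemma irrational_unsquash y : -1 < y < 1 -> (forall r, y <> ratr r) ->
  irrational (unsquash y).
Proof.
move=> y1 yr [r _ ry]; apply: (yr (r / (1 + `|r|))).
rewrite rmorphM fmorphV rmorphD rmorph1 /= ratr_norm ry.
by rewrite -[LHS](unsquashK y1).
Qed.

(* An interval [(a, b)] is cut at a rational [cut a b m], which is the [m]-th
   rational if possible, and then at points converging geometrically from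
   [cut a b m] to [b] (even indices) and to [a] (odd indices). *)
Definition cut a b m : rat :=
  if unpickle m is Some r then if a < r < b then r else (a + b) / 2
  else (a + b) / 2.

Definition subinterval a b m n : rat * rat :=
  let c := cut a b m in
  if odd n then (a + (c - a) * 2^-1 ^+ n./2.+1, a + (c - a) * 2^-1 ^+ n./2)
  else (b - (b - c) * 2^-1 ^+ n./2, b - (b - c) * 2^-1 ^+ n./2.+1).

Definition interval_of s : rat * rat :=
  (foldl (fun q n => (subinterval q.1.1 q.1.2 q.2 n, q.2.+1)) ((-1, 1), 0%N) s).1.

Lemma interval_of_rcons s n : interval_of (rcons s n) =
  subinterval (interval_of s).1 (interval_of s).2 (size s) n.
Proof.
rewrite /interval_of foldl_rcons /=; congr subinterval.
elim/last_ind: s => // s k IH.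
by rewrite foldl_rcons size_rcons /= IH.
Qed.

Lemma cut_itv a b m : a < b -> a < cut a b m < b.
Proof.
move=> ab; rewrite /cut; case: unpickle => [r|]; last by apply/andP; split; lra.
by case: ifP => // _; apply/andP; split; lra.
Qed.

Let half_pow01 k : 0 < (2^-1 : rat) ^+ k <= 1.
Proof.
by rewrite exprn_gt0//= exprn_ile1.
Qed.

Lemma subinterval_lt a b m n (I := subinterval a b m n) : a < b ->
  [/\ a < I.1, I.1 < I.2, I.2 < b, I.2 - I.1 <= (b - a) / 2 &
    if odd n then I.2 <= cut a b m else cut a b m <= I.1].
Proof.
move=> ab; have /andP[ac cb] := cut_itv m ab.
rewrite {}/I /subinterval; case: ifP => on; rewrite /= !exprS;
  have /andP[p0 p1] := half_pow01 n./2; split; try nra.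
Qed.

Lemma interval_of_lt s : [/\ -1 <= (interval_of s).1,
  (interval_of s).1 < (interval_of s).2, (interval_of s).2 <= 1 &
  (interval_of s).2 - (interval_of s).1 <= 2 * 2^-1 ^+ size s].
Proof.
elim/last_ind: s => [|s n [s1 s12 s2 sl]]; first by rewrite /interval_of /=; split.
rewrite interval_of_rcons size_rcons exprS.
by have [? ? ? ? _] := subinterval_lt (size s) n s12; split => //; lra.
Qed.

Let pieces s : set R := [set x | irrational x /\
  ratr (interval_of s).1 < squash x < ratr (interval_of s).2].

Lemma half_pow_bracket (u : R) : 0 < u < 1 ->
  exists k, 2^-1 ^+ k.+1 < u <= 2^-1 ^+ k.
Proof.
move=> /andP[u0 u1]; have [N /(_ N (leqnn N)) uN] := half_exp_small u0.
have ex : exists k, 2^-1 ^+ k < u by exists N.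
case: (ex_minnP ex) => -[|k] ku kmin.
  by rewrite expr0 ltNge ltW in ku.
exists k; rewrite ku leNgt; apply/negP => /kmin.
by rewrite ltnn.
Qed.

Lemma half_pow_disjoint (u : R) j k :
  2^-1 ^+ j.+1 < u < 2^-1 ^+ j -> 2^-1 ^+ k.+1 < u < 2^-1 ^+ k -> j = k.
Proof.
wlog jk : j k / (j < k)%N.
  by case: (ltngtP j k) => [jk H|jk H|//] uj uk; [|apply/esym]; exact: H.
move=> /andP[ju _] /andP[_ uk]; have := lt_trans ju uk.
by rewrite ltNge half_exp_le.
Qed.

Lemma subinterval_odd a b m k y : a < b ->
  let I := subinterval a b m k.*2.+1 in
  (ratr I.1 < y < ratr I.2) =
  (2^-1 ^+ k.+1 < (y - ratr a) / (ratr (cut a b m) - ratr a) < 2^-1 ^+ k).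
Proof.
move=> ab; have /andP[ac cb] := cut_itv m ab.
have d0 : 0 < ratr (cut a b m) - ratr a :> R by rewrite subr_gt0 ltr_rat.
rewrite /subinterval /= odd_double /= uphalf_double.
rewrite (ltr_pdivlMr _ _ d0) (ltr_pdivrMr _ _ d0).
rewrite !rmorphD !rmorphM !rmorphB !rmorphXn !fmorphV !rmorph_nat.
rewrite ltrBrDl ltrBlDl.
by rewrite ![_ * (ratr _ - _)]mulrC.
Qed.

Lemma subinterval_even a b m k y : a < b ->
  let I := subinterval a b m k.*2 in
  (ratr I.1 < y < ratr I.2) =
  (2^-1 ^+ k.+1 < (ratr b - y) / (ratr b - ratr (cut a b m)) < 2^-1 ^+ k).
Proof.
move=> ab; have /andP[ac cb] := cut_itv m ab.
have d0 : 0 < ratr b - ratr (cut a b m) :> R by rewrite subr_gt0 ltr_rat.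
rewrite /subinterval /= odd_double /= doubleK.
rewrite (ltr_pdivlMr _ _ d0) (ltr_pdivrMr _ _ d0).
rewrite !rmorphB !rmorphM !rmorphB !rmorphXn !fmorphV !rmorph_nat.
rewrite ltrBlDr ltrBrDr andbC ltrBrDl ltrBlDl.
by rewrite ![_ * (ratr _ - _)]mulrC.
Qed.

Lemma irrational_scheme : scheme (@irrational R) pieces.
Proof.
have pieces_sub s n : pieces (rcons s n) `<=` pieces s.
  move=> x [ix /andP[x1 x2]]; split=> //; have [_ s12 _ _] := interval_of_lt s.
  have [] := subinterval_lt (size s) n s12; rewrite -interval_of_rcons.
  move=> a1 _ b2 _ _; apply/andP; split.
    by apply: lt_trans x1; rewrite ltr_rat.
  by apply: lt_trans x2 _; rewrite ltr_rat.
split => //.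
- apply/seteqP; split=> [x []//|x ix]; split=> //.
  by rewrite /interval_of /= rmorphN /= rmorph1 squash_itv.
- move=> s x [ix /andP[ax xb]]; have [_ s12 _ _] := interval_of_lt s.
  pose c := cut (interval_of s).1 (interval_of s).2 (size s).
  have /andP[ac cb] : (interval_of s).1 < c < (interval_of s).2 := cut_itv _ s12.
  have xr := irrational_squash ix.
  case: (ltgtP (squash x) (ratr c)) => xc; last by case: (xr c).
    have d0 : 0 < ratr c - ratr (interval_of s).1 :> R by rewrite subr_gt0 ltr_rat.
    have [|k /andP[k1 k2]] := @half_pow_bracket
        ((squash x - ratr (interval_of s).1) / (ratr c - ratr (interval_of s).1)).
      rewrite (ltr_pdivrMr _ _ d0) mul1r ltrD2r xc andbT.
      by rewrite divr_gt0// subr_gt0.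
    exists k.*2.+1; split=> //.
    rewrite interval_of_rcons subinterval_odd// k1/= lt_neqAle k2 andbT.
    apply/eqP => E; apply: (xr ((interval_of s).1 + 2^-1 ^+ k * (c - (interval_of s).1))).
    rewrite rmorphD rmorphM rmorphB rmorphXn fmorphV rmorph_nat /= -E.
    by rewrite divfK ?gt_eqF// addrC subrK.
  have d0 : 0 < ratr (interval_of s).2 - ratr c :> R by rewrite subr_gt0 ltr_rat.
  have [|k /andP[k1 k2]] := @half_pow_bracket
      ((ratr (interval_of s).2 - squash x) / (ratr (interval_of s).2 - ratr c)).
    rewrite (ltr_pdivrMr _ _ d0) mul1r ltrD2l ltrN2 xc andbT.
    by rewrite divr_gt0// subr_gt0.
  exists k.*2; split=> //.
  rewrite interval_of_rcons subinterval_even// k1/= lt_neqAle k2 andbT.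
  apply/eqP => E; apply: (xr ((interval_of s).2 - 2^-1 ^+ k * ((interval_of s).2 - c))).
  rewrite rmorphB rmorphM rmorphB rmorphXn fmorphV rmorph_nat /= -E.
  by rewrite divfK ?gt_eqF// subKr.
- move=> s x m n [ix xm] [_ xn]; have [_ s12 _ _] := interval_of_lt s.
  have [_ _ _ _] := subinterval_lt (size s) m s12.
  have [_ _ _ _] := subinterval_lt (size s) n s12.
  move: xm xn; rewrite !interval_of_rcons -[m]odd_double_half -[n]odd_double_half.
  case: (odd m); case: (odd n); rewrite ?add0n ?add1n.
  + rewrite !subinterval_odd// => um un _ _.
    by rewrite (half_pow_disjoint um un).
  + move=> /andP[_ xm] /andP[xn _]; rewrite /= !odd_double /= => cn mc.
    by have := lt_trans xn xm; rewrite ltr_rat ltNge (le_trans mc cn).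
  + move=> /andP[xm _] /andP[_ xn]; rewrite /= !odd_double /= => cn mc.
    by have := lt_trans xm xn; rewrite ltr_rat ltNge (le_trans cn mc).
  + rewrite !subinterval_even// => um un _ _.
    by rewrite (half_pow_disjoint um un).
- move=> t; pose I n := interval_of (mkseq t n).
  have IS n : I n.+1 = subinterval (I n).1 (I n).2 n (t n).
    by rewrite /I mkseqS interval_of_rcons size_mkseq.
  have I12 n : (I n).1 < (I n).2 by have [] := interval_of_lt (mkseq t n).
  have I1 n : (I n).1 < (I n.+1).1.
    by rewrite IS; have [] := subinterval_lt n (t n) (I12 n).
  have I2 n : (I n.+1).2 < (I n).2.
    by rewrite IS; have [] := subinterval_lt n (t n) (I12 n).
  have I1m j n : (j <= n)%N -> (I j).1 <= (I n).1.
    move=> /subnK <-; elim: (n - j)%N => // k IH.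
    by apply: le_trans IH _; rewrite addSn ltW.
  have I2m j n : (j <= n)%N -> (I n).2 <= (I j).2.
    move=> /subnK <-; elim: (n - j)%N => // k IH.
    by apply: le_trans _ IH; rewrite addSn ltW.
  have Imn j n : (I j).1 < (I n).2.
    case: (leqP j n) => [/I1m|/ltnW/I2m] h; first exact: le_lt_trans h _.
    exact: lt_le_trans h.
  pose y : R := sup (range (fun n => ratr (I n).1)).
  have hs : has_sup (range (fun n => ratr (I n).1 : R)).
    split; first by exists (ratr (I 0%N).1); exists 0%N.
    by exists (ratr (I 0%N).2) => _ [n _ <-]; rewrite ler_rat ltW.
  have yI n : ratr (I n).1 < y < ratr (I n).2.
    apply/andP; split.
      apply: lt_le_trans (_ : ratr (I n.+1).1 <= _); first by rewrite ltr_rat.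
      by apply: ub_le_sup; [case: hs | exists n.+1].
    apply: le_lt_trans (_ : _ <= ratr (I n.+1).2) _; last by rewrite ltr_rat.
    apply: ge_sup; first by case: hs.
    by move=> _ [k _ <-]; rewrite ler_rat ltW.
  have y1 : -1 < y < 1.
    by have := yI 0%N; rewrite /I /interval_of /= rmorphN /= rmorph1.
  exists (unsquash y) => n; split; last by rewrite unsquashK//; exact: yI.
  apply: irrational_unsquash => // r yr.
  pose m := pickle r; have := yI m; rewrite {}yr !ltr_rat in yI *.
  move=> rm; have cr : cut (I m).1 (I m).2 m = r by rewrite /cut pickleK rm.
  have := yI m.+1; rewrite !ltr_rat IS.
  have [_ _ _ _] := subinterval_lt m (t m) (I12 m); rewrite cr.
  case: ifP => _ h /andP[].
    by move=> _; rewrite ltNge h.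
  by rewrite ltNge h.
- move=> s x [ix /andP[ax xb]].
  have sx := @squash_continuous x.
  near=> z => iz; split => //; apply/andP; split; near: z.
    exact: (sx _ (lt_nbhsr ax)).
  exact: (sx _ (lt_nbhsl xb)).
- move=> t x P tx xP.
  have y1 := squash_itv x; rewrite -(squashK x) in xP.
  have /nbhs_ballP[e /= e0 eP] := unsquash_continuous y1 xP.
  have [N /(_ N (leqnn N)) Ne] := half_exp_small (divr_gt0 e0 (ltr0n R 2)).
  exists N => z [iz /andP[z1 z2]]; rewrite -(squashK z); apply: eP.
  have [_ /andP[x1 x2]] := tx N; have [_ _ _] := interval_of_lt (mkseq t N).
  rewrite size_mkseq -(ler_rat R) rmorphB rmorphM rmorphXn fmorphV rmorph_nat /=.
  move=> l; rewrite -ball_normE /= ltr_norml; apply/andP; split; lra.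
Unshelve. all: by end_near. Qed.

End irrational_scheme.

(** * Irrational endpoints *)

Section regions.
Implicit Types (c d : cantor_space) (i j k n v : nat).
Local Open Scope nat_scope.

Definition first_odd k j c : Prop :=
  [/\ k <= j, odd j, c j & forall i, k <= i < j -> ~~ c i].

Definition first_even k c : Prop := forall j, ~ first_odd k j c.

(* A triple [(b, v, i)] stands for the set of [c] whose first [2 i] bits
   spell [v] and, if [b] holds, whose next nonzero bit, if any, has even index. *)
Definition region (s : bool * nat * nat) : set cantor_space :=
  let: (b, v, i) := s in
  [set c | value i.*2 c = v /\ (b -> first_even i.*2 c)].

Definition child (s : bool * nat * nat) n : bool * nat * nat :=
  let: (b, v, i) := s in
  if b then
    let w := v + 2 ^ i.*2 in
    match n with
    | 0 => (true, v, i.+1)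
    | 1 => (true, w, i.+1)
    | n.+2 => (false, w + 2 ^ (i + n).*2.+1, (i + n).+1)
    end
  else
    if n is n.+1 then (false, v + 2 ^ (i + n).*2.+1, (i + n).+1)
    else (true, v, i).

Definition state s := foldl child (false, 0, 0) s.

Lemma state_rcons s n : state (rcons s n) = child (state s) n.
Proof. exact: foldl_rcons. Qed.

Lemma ltn_exp_double i j v : i <= j -> v < 2 ^ i -> v + 2 ^ j < 2 ^ j.+1.
Proof.
move=> ij vi; rewrite expnS.
have : 2 ^ i <= 2 ^ j by rewrite leq_exp2l.
lia.
Qed.

Lemma state_lt s : (state s).1.2 < 2 ^ (state s).2.*2.
Proof.
elim/last_ind: s => // s n; rewrite state_rcons.
case: (state s) => -[[] v] i /= vi; last first.
  case: n => [//|n] /=; rewrite doubleS.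
  by apply: (ltn_exp_double _ vi); lia.
have wi : v + 2 ^ i.*2 < 2 ^ i.*2.+1 by exact: ltn_exp_double vi.
case: n => [|[|n]] /=; rewrite doubleS.
- by apply: ltn_trans vi _; rewrite ltn_exp2l.
- by apply: ltn_trans wi _; rewrite ltn_exp2l.
- by apply: (ltn_exp_double _ wi); lia.
Qed.

Lemma value_gap k j c : k <= j -> value j c < 2 ^ k ->
  value k c = value j c /\ forall i, k <= i < j -> ~~ c i.
Proof.
move=> kj vk; have gap i : k <= i < j -> ~~ c i.
  move=> /andP[ki ij]; apply/negP => ci; have := value_ge ij ci.
  have : 2 ^ k <= 2 ^ i by rewrite leq_exp2l.
  lia.
by split=> //; rewrite (value_const kj gap).
Qed.

Lemma value_next k j c v : k <= j -> v < 2 ^ k ->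
  value j.+1 c = v + 2 ^ j <->
  [/\ value k c = v, c j & forall i, k <= i < j -> ~~ c i].
Proof.
move=> kj vk; rewrite valueS.
have kj2 : 2 ^ k <= 2 ^ j by rewrite leq_exp2l.
have vj := value_lt j c; split=> [|[vc -> gap]]; last first.
  by rewrite /= mul1n (value_const kj gap) vc.
case: (c j) => /= E; last by lia.
have vE : value j c = v by lia.
by have [|vkj gap] := value_gap kj (c := c); [rewrite vE|rewrite vkj].
Qed.

Lemma first_odd_inj k i j c : first_odd k i c -> first_odd k j c -> i = j.
Proof.
move=> [ki _ ci gi] [kj _ cj gj].
case: (ltngtP i j) => // ij.
  by have := gj i; rewrite ki ij ci => /(_ isT).
by have := gi j; rewrite kj ij cj => /(_ isT).
Qed.

Lemma first_even_gap j k c : j <= k -> (forall i, j <= i < k -> ~~ c i) ->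
  first_even j c <-> first_even k c.
Proof.
move=> jk gap; split=> fe i [ai oi ci gi]; apply: (fe i); split=> //.
- exact: leq_trans ai.
- move=> a /andP[ja ai']; case: (leqP k a) => ka; first by apply: gi; rewrite ka.
  by apply: gap; rewrite ja.
- rewrite leqNgt; apply/negP => ik.
  by have := gap i; rewrite ai ik ci => /(_ isT).
- by move=> a /andP[ka ai']; apply: gi; rewrite (leq_trans jk).
Qed.

Lemma first_even_one k c : ~~ odd k -> c k -> first_even k c.
Proof.
move=> ek ck j [kj oj cj gap]; have : k != j by apply: contraNneq ek => ->.
rewrite neq_ltn => /orP[kj'|]; last by rewrite ltnNge kj.
by have := gap k; rewrite leqnn kj' ck => /(_ isT).
Qed.

Lemma child_false v i n c : v < 2 ^ i.*2 ->
  region (child (false, v, i) n) c <-> region (false, v, i) c /\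
    (if n is m.+1 then first_odd i.*2 (i + m).*2.+1 c else first_even i.*2 c).
Proof.
move=> vi; case: n => [|m] /=.
  by split=> [[vc /(_ isT) fe]|[[vc _] fe]]; split.
have ij : i.*2 <= (i + m).*2.+1 by lia.
rewrite doubleS; split=> [[/(value_next c ij vi)[? ? ?] _]|[[vc _] [_ _ cj gap]]].
  by split=> //; split=> //; rewrite /= odd_double.
by split=> //; apply/(value_next c ij vi).
Qed.

Lemma child_true v i n c : v < 2 ^ i.*2 ->
  region (child (true, v, i) n) c <-> region (true, v, i) c /\
    match n with
    | 0 => ~~ c i.*2
    | 1 => c i.*2 /\ first_even i.*2.+1 c
    | m.+2 => c i.*2 /\ first_odd i.*2.+1 (i + m).*2.+1 c
    end.
Proof.
move=> vi; have wi : v + 2 ^ i.*2 < 2 ^ i.*2.+1 by exact: ltn_exp_double vi.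
have ei : ~~ odd i.*2 by rewrite odd_double.
have valueSE := value_next c (leqnn i.*2) vi.
case: n => [|[|m]] /=; rewrite ?doubleS.
- have i2 : i.*2 <= i.*2.+2 by rewrite leqW// leqW.
  split=> [[vc /(_ isT) fe]|[[vc /(_ isT) fe] c0]].
    have [|vk gap] := value_gap i2 (c := c); first by rewrite vc.
    have c0 : ~~ c i.*2 by apply: gap; rewrite leqnn ltnS leqnSn.
    by rewrite vk vc; split=> //; split=> // _; apply/(first_even_gap i2 gap).
  have c1 : ~~ c i.*2.+1.
    apply/negP => c1; apply: (fe i.*2.+1); split=> [|/=|//|j jj] //.
    by have -> : j = i.*2 by lia.
  have gap j : i.*2 <= j < i.*2.+2 -> ~~ c j.
    move=> jj; have [->//|->//] : j = i.*2 \/ j = i.*2.+1 by lia.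
  split; first by rewrite (value_const i2 gap).
  by move=> _; apply/(first_even_gap i2 gap).
- have gapE : ~~ c i.*2.+1 -> forall j, i.*2.+1 <= j < i.*2.+2 -> ~~ c j.
    by move=> c1 j jj; have -> : j = i.*2.+1 by lia.
  split=> [[vc /(_ isT) fe]|[[vc _] [c0 fe]]].
    have [|vk gap] := value_gap (leqnSn i.*2.+1) (c := c); first by rewrite vc.
    rewrite vc in vk; have [vc' c0 _] := valueSE.1 vk.
    split; first by split=> // _; exact: first_even_one.
    by split=> //; apply/(first_even_gap (leqnSn _) gap).
  have c1 : ~~ c i.*2.+1.
    apply/negP => c1; apply: (fe i.*2.+1); split=> [|/=|//|j] //; lia.
  have gap := gapE c1; split; last first.
    by move=> _; apply/(first_even_gap (leqnSn _) gap).
  rewrite (value_const (leqnSn _) gap); apply/valueSE; split=> // j; lia.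
- have ij : i.*2.+1 <= (i + m).*2.+1 by lia.
  have nextE := value_next c ij wi.
  split=> [[/nextE[vc cj gap] _]|[[vc _] [c0 [_ _ cj gap]]]].
    have [vc' c0 _] := valueSE.1 vc.
    split; first by split=> // _; exact: first_even_one.
    by split=> //; split=> //; rewrite /= odd_double.
  split=> //; apply/nextE; split=> //; apply/valueSE; split=> // j; lia.
Qed.

Lemma odd_index k j : k <= j -> odd j -> exists m, j = (k./2 + m).*2.+1.
Proof.
move=> kj oj; exists (j./2 - k./2); rewrite subnKC ?half_leq//.
by rewrite -[LHS]odd_double_half oj add1n.
Qed.

Lemma region_sub s n : region (state (rcons s n)) `<=` region (state s).
Proof.
move=> c; rewrite state_rcons; have := state_lt s.
case: (state s) => -[[] v] i /= vi.
  by move=> /(child_true n c vi)[].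
by move=> /(child_false n c vi)[].
Qed.

Lemma region_cover s c : region (state s) c ->
  exists n, region (state (rcons s n)) c.
Proof.
under eq_exists do rewrite state_rcons.
have := state_lt s; case: (state s) => -[[] v] i /= vi cs.
  case: (boolP (c i.*2)) => ci; last first.
    by exists 0; apply/(child_true 0 c vi).
  case: (pselect (first_even i.*2.+1 c)) => [fe|].
    by exists 1; apply/(child_true 1 c vi).
  move=> /existsNP[j /contrapT fo]; have [ij oj _ _] := fo.
  have [m jE] := odd_index ij oj; exists m.+2; apply/(child_true m.+2 c vi).
  by split=> //; split=> //; move: fo; rewrite jE /= uphalf_double.
case: (pselect (first_even i.*2 c)) => [fe|].
  by exists 0; apply/(child_false 0 c vi).
move=> /existsNP[j /contrapT fo]; have [ij oj _ _] := fo.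
have [m jE] := odd_index ij oj; exists m.+1; apply/(child_false m.+1 c vi).
by split=> //; move: fo; rewrite jE doubleK.
Qed.

Lemma region_disjoint s c m n : region (state (rcons s m)) c ->
  region (state (rcons s n)) c -> m = n.
Proof.
rewrite !state_rcons; have := state_lt s.
case: (state s) => -[[] v] i /= vi.
  move=> /(child_true m c vi)[_ cm] /(child_true n c vi)[_ cn].
  case: m n cm cn => [|[|m]] [|[|n]] //.
  - by move=> /negP c0 [].
  - by move=> /negP c0 [].
  - by move=> [+ _] /negP.
  - by move=> [_ fe] [_ /fe].
  - by move=> [+ _] /negP.
  - by move=> [_ fo] [_ fe]; case: (fe _ fo).
  - move=> [_ f1] [_ f2]; have := first_odd_inj f1 f2; lia.
move=> /(child_false m c vi)[_ cm] /(child_false n c vi)[_ cn].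
case: m n cm cn => [|m] [|n] //.
- by move=> fe /fe.
- by move=> fo /(_ _ fo).
- by move=> f1 f2; have := first_odd_inj f1 f2; lia.
Qed.

Lemma region_bits s : region (state s) (bits (state s).1.2).
Proof.
have := state_lt s; case: (state s) => -[b v] i /= vi; split.
  by rewrite value_bits_mod modn_small.
move=> _ j [ij _ + _]; rewrite /bits divn_small//.
by apply: leq_trans vi _; rewrite leq_exp2l.
Qed.

Lemma region_agree s c d : region (state s) c -> region (state s) d ->
  agree (state s).2.*2 c d.
Proof.
case: (state s) => -[b v] i /= [vc _] [vd _] j ij.
have := agree_bits_value c ij; have := agree_bits_value d ij.
by rewrite vc vd => <-.
Qed.

Lemma state_depth (a : nat -> nat) n : n <= (state (mkseq a n.*2)).2.
Proof.
elim: n => // n IH; rewrite doubleS !mkseqS !state_rcons.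
case: (state _) IH => -[[] v] i /= IH; last first.
  by case: (a n.*2) => [|k] /=; [case: (a _) => [|[|?]]|case: (a _)] => /=; lia.
by case: (a n.*2) => [|[|k]] /=; case: (a _) => [|[|?]] /=; lia.
Qed.

Lemma state_mono (a : nat -> nat) m n : m <= n ->
  region (state (mkseq a n)) `<=` region (state (mkseq a m)).
Proof.
move=> /subnK <-; elim: (n - m) => // k IH; rewrite addSn mkseqS.
by apply: subset_trans IH; exact: region_sub.
Qed.

Lemma state_depth_le (a : nat -> nat) m n : m <= n ->
  (state (mkseq a m)).2 <= (state (mkseq a n)).2.
Proof.
move=> /subnK <-; elim: (n - m) => // k IH; rewrite addSn mkseqS state_rcons.
apply: leq_trans IH _; case: (state _) => -[[] v] i /=.
  by case: (a _) => [|[|?]] /=; lia.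
by case: (a _) => [|?] /=; lia.
Qed.

Lemma region_branch (a : nat -> nat) : exists c, forall n, region (state (mkseq a n)) c.
Proof.
pose cc n := bits (state (mkseq a n)).1.2.
have ccP m n : m <= n -> region (state (mkseq a m)) (cc n).
  by move=> mn; apply: (state_mono mn); exact: region_bits.
pose c : cantor_space := fun j => cc j.+1.*2 j.
have cE n : agree (state (mkseq a n)).2.*2 c (cc n).
  move=> j jn; rewrite /c; case: (leqP n j.+1.*2) => jn'.
    exact: (region_agree (ccP _ _ jn') (ccP _ _ (leqnn _))).
  apply/esym; apply: (region_agree (ccP _ _ (ltnW jn')) (ccP _ _ (leqnn _))).
  by have := state_depth a j.+1; lia.
exists c => n; have := cE n; have := ccP n n (leqnn n).
have fe j : first_odd (state (mkseq a n)).2.*2 j c ->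
    first_odd (state (mkseq a n)).2.*2 j (cc (maxn n j.+1.*2)).
  move=> [nj oj cj gap]; pose m := maxn n j.+1.*2.
  have cm i : i <= j -> cc m i = c i.
    move=> ij; apply/esym/(cE m).
    have := state_depth_le a (leq_maxr n j.+1.*2).
    have := state_depth a j.+1; rewrite -/m; lia.
  split=> //; first by rewrite -/m cm.
  by move=> i /andP[ni ij]; rewrite cm; [apply: gap; rewrite ni|exact: ltnW].
case E : (state (mkseq a n)) => [[b v] i] /= [vn bn] cn.
rewrite E /= in fe; split; first by rewrite (agree_value cn).
move=> b1 j /fe; have := ccP n _ (leq_maxl n j.+1.*2).
by rewrite E /= => -[_ /(_ b1)] h; exact: h.
Qed.

End regions.

Section irrational_endpoints.
Context {R : realType} (K : nat -> set R).
Hypothesis K_compact : forall n, compact (K n).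
Hypothesis K_sub : forall n, K n `<=` `]0, 1[.
Hypothesis K_neq0 : forall n, K n <> set0.
Implicit Types c d : cantor_space.

Section large_data.
Context (Kt : nat -> set R) (q : nat -> nat -> R).
Hypothesis data : forall n, node_data (K n) (Kt n) (q n).
Hypothesis Kt_large : forall n x, Kt n x -> 1 - 2^-1 ^+ n.+2 <= x.

Local Notation l := (profile odd q).

Let q01 : forall n j, 0 <= q n j <= 1 := node01 data.

Let q_in n j : Kt n (q n j).
Proof. by apply: (node_in data); exact: (node_gt0 data). Qed.

Let q_large n k : 1 - 2^-1 ^+ n.+2 <= q n k.
Proof. exact/Kt_large/q_in. Qed.

Let l_gt0 c : 0 < l c.
Proof.
by apply: lt_le_trans (large_profile_ge odd q01 q_large c); rewrite invr_gt0.
Qed.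

Lemma large_isolated n : exists2 e, 0 < e & forall d k, (n <= k)%N ->
  agree k (bits n) d -> `|l d - l (bits n)| < e -> first_even k d.
Proof.
have [_ Kt_closed K1 _ _] := data n.
have nK1 : nbhs (1 : R) (~` Kt n).
  apply: open_nbhs_nbhs; split; first exact: closed_openC.
  by move=> /K1; rewrite /= in_itv/= ltxx andbF.
have /nbhs_ballP[e /= e0 eK] := nK1.
exists (l (bits n) * e); first by rewrite mulr_gt0.
move=> d k nk nd dl j [kj oj dj gap].
have vk : value k d = n by rewrite -(agree_value nd) value_bits.
have vj : value j d = n by rewrite (value_const kj gap).
have nj : agree j (bits n) d by rewrite -vj; exact/agree_sym/agree_bits_value.
have := profile_le odd q01 j.+1 d; rewrite partial_heightS /factor oj dj vj.
rewrite -(agree_partial_height odd q nj) -profile_bits//; last exact: leq_trans nk kj.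
move=> /= ldj; apply: (eK (q n j)) (q_in n j).
rewrite -ball_normE /= ger0_norm; last by rewrite subr_ge0; case/andP: (q01 n j).
rewrite -(ltr_pM2l (l_gt0 (bits n))) mulrBr mulr1.
by move: dl; rewrite ltr_distl => /andP[dl _]; lra.
Qed.

Context (X : fan_model l).

Let endE : endpoints X = range (tip X).
Proof.
have b01 : bits 0 <> bits 1 by move=> /bits_inj.
rewrite (fan_endpoints X b01 (l_gt0 _) (l_gt0 _)); congr image.
by apply/seteqP; split=> // c _; exact: l_gt0.
Qed.

Definition tip_region s : set X := tip X @` region (state s).

Let tip_inj c d : tip X c = tip X d -> c = d.
Proof.
move=> /(congr1 (@leg R l X)).
by rewrite (leg_tip X (l_gt0 c)) (leg_tip X (l_gt0 d)).
Qed.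

Let tip_nbhs c (P : set X) : nbhs (tip X c) P -> exists k e, 0 < e /\
  forall d, agree k c d -> `|l d - l c| < e -> P (tip X d).
Proof.
move=> /nbhs_mdistP[e e0 eP]; have e3 : 0 < e / 3 by rewrite divr_gt0.
have /nbhs_cantorP[k kc] := @near_ternary R c _ e3.
exists k, (e / 3); split=> // d cd dl; apply: eP.
apply: le_lt_trans (mdist_le_pt _ _) _; first by rewrite lexx ltW.
rewrite height_tip leg_tip//; have := kc d cd; rewrite distrC in dl; lra.
Qed.

Lemma tip_region_open s x :
  tip_region s x -> \forall y \near x, endpoints X y -> tip_region s y.
Proof.
rewrite endE /tip_region; case: (state s) => -[b v] i [c [vc cb] <-].
suff [k [e [ik e0 kP]]] : exists k e, [/\ (i.*2 <= k)%N, 0 < e &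
    forall d, agree k c d -> `|l d - l c| < e -> b -> first_even i.*2 d].
  have := near_tip X k (l_gt0 c) e0; apply: filterS => y + [d _ dy].
  rewrite -dy leg_tip// height_tip => -[cd dl]; exists d => //; split.
    by rewrite -(agree_value (agree_le ik cd)).
  exact: kP.
case: b cb => [/(_ isT) fe|_]; last by exists i.*2, 1.
case: (pselect (exists2 j, (i.*2 <= j)%N & c j)) => [/first_one[j [ij cj gap]]|nc].
  have ej : ~~ odd j.
    by apply/negP => oj; apply: (fe j); split.
  exists j.+1, 1; split=> [||d cd _ _] //; first by rewrite leqW.
  apply/(first_even_gap ij).
    by move=> a /andP[ia aj]; rewrite -cd ?ltnS 1?ltnW// gap// ia.
  by apply: first_even_one => //; rewrite -cd.
have ci a : (i.*2 <= a)%N -> ~~ c a by move=> ia; apply/negP => ca; apply: nc; exists a.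
have cE : bits v = c by rewrite -vc bits_value_eq.
have [e e0 eP] := large_isolated v; exists (maxn v i.*2), e.
split=> [||d cd dl _] //; first by rewrite leq_maxr.
apply/(first_even_gap (leq_maxr v i.*2)).
  by move=> a /andP[ia av]; rewrite -cd// ci.
by apply: eP; rewrite ?cE ?leq_maxl.
Qed.

Lemma tip_region_base (a : nat -> nat) x (P : set X) :
  (forall n, tip_region (mkseq a n) x) -> nbhs x P ->
  exists n, tip_region (mkseq a n) `<=` P.
Proof.
move=> ax xP; have [c _ cx] := ax 0%N.
have ac n : region (state (mkseq a n)) c.
  by have [d dn dx] := ax n; rewrite (tip_inj (etrans cx (esym dx))).
rewrite -cx in xP; have [k [e [e0 kP]]] := tip_nbhs xP.
have [N hN] := half_exp_small e0.
suff [n kn nl] : exists2 n, (k <= (state (mkseq a n)).2.*2)%N &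
    forall d, region (state (mkseq a n)) d -> `|l d - l c| < e.
  exists n => _ [d dn <-]; apply: kP; last exact: nl.
  exact: agree_le kn (region_agree (ac n) dn).
case: (pselect (range bits c)) => [[w _ wc]|nc]; last first.
  have [k' k'c] := not_bits_value N nc; pose M := maxn k k'.
  have Mn : (M <= (state (mkseq a M.*2)).2.*2)%N.
    by have := state_depth a M; lia.
  exists M.*2; first by apply: leq_trans Mn; rewrite leq_maxl.
  move=> d dn; have cd := agree_le Mn (region_agree (ac _) dn).
  have := profile_partial odd q01 q_large M d.
  have := profile_partial odd q01 q_large M c.
  rewrite -(agree_partial_height odd q cd) -(agree_value cd).
  have : 2^-1 ^+ (value M c).+1 < e.
    by apply: hN; rewrite leqW// k'c// leq_maxr.
  by move=> ? /andP[? ?] /andP[? ?]; rewrite ltr_distl; apply/andP; split; lra.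
pose M := maxn k (maxn w N).
have [n [Mn bn]] : exists n,
    (M <= (state (mkseq a n)).2.*2)%N /\ (state (mkseq a n)).1.1.
  have M1 : (M <= (state (mkseq a M.*2)).2.*2)%N.
    by have := state_depth a M; lia.
  case: (boolP (state (mkseq a M.*2)).1.1) => [b|/negbTE b]; first by exists M.*2.
  exists (M.*2).+1; split.
    by apply: leq_trans M1 _; rewrite leq_double; exact: state_depth_le.
  have := ac M.*2.+1; have := state_lt (mkseq a M.*2).
  rewrite mkseqS state_rcons; case: (state _) b M1 => -[b v] i /= -> M1 vi.
  move=> /(child_false _ c vi)[_]; case: (a _) => // m [ij _ + _].
  rewrite -wc bits_high//; apply: leq_trans ij; apply: leq_trans M1.
  by rewrite !leq_max leqnn orbT.
exists n; first by apply: leq_trans Mn; rewrite leq_maxl.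
have wM : (w <= (state (mkseq a n)).2.*2)%N.
  by apply: leq_trans Mn; rewrite !leq_max leqnn orbT.
have NM : (N <= (state (mkseq a n)).2.*2)%N.
  by apply: leq_trans Mn; rewrite !leq_max leqnn !orbT.
move=> d dn; case: (pselect (d = c)) => [->|dc]; first by rewrite subrr normr0.
have cd := region_agree (ac n) dn.
move: bn wM NM dn cd; case: (state _) => -[b v] i /= -> wM NM [vd /(_ isT) fe].
rewrite -wc => wd; have [|j [ij dj vj wj]] := first_one_bits wM wd.
  by rewrite wc.
have ej : ~~ odd j.
  apply/negP => oj; apply: (fe j); split=> // t /andP[it tj].
  by rewrite -wj// bits_high// (leq_trans wM).
have := profile_partial odd q01 q_large j.+1 d.
rewrite partial_heightS /factor (negbTE ej) mulr1.
rewrite -(agree_partial_height odd q wj) -profile_bits//; last exact: leq_trans ij.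
have : 2^-1 ^+ (value j.+1 d).+1 < e.
  apply: hN; rewrite valueS dj mul1n; have := ltn_expl j (ltnSn 1); lia.
by move=> ? /andP[? ?]; rewrite ltr_distl; apply/andP; split; lra.
Qed.

Lemma tip_region_scheme : scheme (endpoints X) tip_region.
Proof.
split.
- rewrite endE /tip_region; congr image; apply/seteqP; split=> // c _.
  by split; rewrite ?value0.
- by move=> s n _ [c cs <-]; exists c => //; exact: region_sub cs.
- by move=> s _ [c /region_cover[n cn] <-]; exists n, c.
- move=> s _ m n [c cm <-] [d dn /tip_inj dc]; rewrite dc in dn.
  exact: region_disjoint cm dn.
- by move=> a; have [c ca] := region_branch a; exists (tip X c) => n; exists c.
- exact: tip_region_open.
- exact: tip_region_base.
Qed.

Lemma large_K_fan : [/\ K_fan_with K (vertex X) (tip X \o bits),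
  homeomorphic (endpoints X) (@irrational R) &
  forall x, (endpoints X `\` range (tip X \o bits)) x ->
    closure (endpoints X) `&` arc_joining (vertex X) x = [set x]].
Proof.
have q_pos n k : 0 < q n k -> Kt n (q n k) by move=> _; exact: q_in.
have liveT : [set c | 0 < l c] = setT.
  by apply/seteqP; split=> // c _; exact: l_gt0.
have closedKt n : closed (Kt n) by have [] := data n.
split.
- apply: (@K_fan_criterion _ _ X K Kt) => //.
  + exact: bits_inj.
  + by move=> n; have [] := data n.
  + by move=> n; have [] := data n.
  + move=> n t tl; split=> [|[u Ku ->]].
      exact: (large_limit_node q01 closedKt q_pos q_large).
    by apply: (node_limit _ data).
  + by move=> c t _ nc tl; exact: (large_limit_other q01 q_large).
  + move=> c lc _; have := limit_height_top q01 lc.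
    congr (limit_height l _ c (l c)); congr image.
    by apply/seteqP; split=> // n _; exact: l_gt0.
- apply: (scheme_homeomorphic _ _ tip_region_scheme irrational_scheme).
    exact: metric_hausdorff.
  exact: Rhausdorff.
- move=> x; rewrite endE => -[[c _ <-] nc].
  have {}nc : ~ range bits c by move=> [n _ nE]; apply: nc; exists n; rewrite //= nE.
  rewrite arc_joining_tip//; apply/seteqP; split=> y.
    move=> [yE ys]; case: (pselect (y = vertex X)) => [yv|yv].
      exfalso; move: yE; rewrite yv; apply: (@closure_tips_vertexF _ _ X setT 2^-1).
        by rewrite invr_gt0.
      by move=> d _; exact: (large_profile_ge odd q01 q_large).
    case: ys => [//|yc]; have y0 := height_gt0 yv.
    have yl := height_le y0; rewrite yc in yl.
    apply: fan_ext; rewrite ?leg_tip// height_tip; apply/eqP.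
    rewrite eq_le yl leNgt; apply/negP => yl'.
    apply: (large_limit_other (m := odd) q01 q_large nc (t := height y)).
      by rewrite y0.
    by rewrite -yc liveT; apply/closure_tips.
  move=> ->; split; last by right; rewrite leg_tip.
  by apply: subset_closure; exists c.
Qed.

End large_data.

Lemma K_fan_irrational :
  exists (X : metricType R) (p : X) (e : nat -> X),
    [/\ K_fan_with K p e, homeomorphic (endpoints X) (@irrational R) &
      forall x, (endpoints X `\` range e) x ->
        closure (endpoints X) `&` arc_joining p x = [set x]].
Proof.
have [Kt [q [data large]]] := large_node_family K_compact K_sub.
have [X] := profile_fan odd (node01 data).
by exists X, (vertex X), (tip X \o bits); exact: large_K_fan data large X.
Qed.

End irrational_endpoints.

Theorem proposition7 (R : realType) (K : nat -> set R)
    (K_compact : forall n, compact (K n))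
    (K_sub : forall n, K n `<=` `]0, 1[)
    (K_noniso : forall m n, m <> n -> ~ order_isomorphic (K m) (K n)) :
  (exists (X : metricType R) (p : X), K_fan K p) /\
  [/\ (forall n, K n <> set0) ->
       exists (X : metricType R) (p : X) (e : nat -> X),
         [/\ K_fan_with K p e,
             homeomorphic (endpoints X) [set: nat] &
             endpoints X = range e],
      (forall n, K n <> set0) ->
       exists (X : metricType R) (p : X) (e : nat -> X),
         [/\ K_fan_with K p e,
             homeomorphic (endpoints X) (@irrational R) &
             forall x, (endpoints X `\` range e) x ->
               closure (endpoints X) `&` arc_joining p x = [set x]] &
      (forall n, K n <> set0) ->
       exists (X : metricType R) (p : X) (e : nat -> X),
         [/\ K_fan_with K p e,
             homeomorphic (endpoints X) [set: cantor_space * nat] &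
             forall x, (endpoints X `\` range e) x ->
               closure (endpoints X) `&` arc_joining p x = [set p; x]]].
Proof.
split; first exact: K_fan_exists K_compact K_sub K_noniso.
split=> K0.
- exact: K_fan_discrete K_compact K_sub K0.
- exact: K_fan_irrational K_compact K_sub K0.
- exact: K_fan_cantor_nat K_compact K_sub K0.
Qed.
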